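(* Let $A=\mathbb{Z}\langle x,y\rangle/(f)$, where $f\in\mathbb{Z}\langle x,y\rangle$ is a homogeneous (noncommutative) polynomial of degree $m$ whose abelianization $f_{\mathrm{ab}}\in\mathbb{Z}[x,y]$ is nonzero. Let $s$ be the number of distinct (i.e. pairwise non-proportional) linear factors of $f_{\mathrm{ab}}$ over $\mathbb{C}$. Then \[\mathrm{Rank}(N_2(A)[d])=\begin{cases}0 & d=0\\ d-1 & 1\leq d\leq m-1 \\ 2m-d-1 & m\leq d\leq m+s-1 \\ m-s & d\geq m+s.\end{cases}\]
   Context: $\mathbb{Z}\langle x,y\rangle$ is the free associative unital ring on $x,y$, graded by $\deg x=\deg y=1$; $(f)$ is the two-sided ideal generated by $f$, and $A$ inherits the grading. The abelianization $f_{\mathrm{ab}}$ is the image of $f$ under the natural map $\mathbb{Z}\langle x,y\rangle\to\mathbb{Z}[x,y]$; over $\mathbb{C}$ a nonzero homogeneous $f_{\mathrm{ab}}$ is a product of linear forms $\alpha x+\beta y$. For an associative unital algebra $A$, let $[a,b]=ab-ba$, let $L_1(A)=A$ and $L_{k+1}(A)=[A,L_k(A)]$ (the additive span of all $[a,b]$ with $a\in A$, $b\in L_k(A)$), let $M_k(A)$ be the two-sided ideal of $A$ generated by $L_k(A)$, and let $N_k(A)=M_k(A)/M_{k+1}(A)$. These inherit the grading, and $N_2(A)[d]$ denotes the degree $d$ part. $\mathrm{Rank}$ is the rank of a finitely generated abelian group. *)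

(* Defs.v *)
From HB Require Import structures.
From mathcomp Require Import all_boot all_order all_algebra.
From mathcomp Require Import ring_quotient complex.
From mathcomp Require Import boolp classical_sets functions cardinality reals.
(* monalg and mpoly declare conflicting notations (e.g. {mpoly R[n]}); only
   those of mpoly are activated, and monalg is used through its constants. *)
From mathcomp Require Import -(notations) monalg.
From mathcomp Require Import mpoly.

Set Implicit Arguments.
Unset Strict Implicit.
Unset Printing Implicit Defensive.

Import GRing.Theory.
Local Open Scope classical_set_scope.
Local Open Scope ring_scope.

Definition is_subgroup (V : zmodType) (H : set V) : Prop :=
  [/\ H 0, (forall u v, H u -> H v -> H (u + v)) & (forall u, H u -> H (- u))].

Definition is_ideal2 (R : pzRingType) (I : set R) : Prop :=
  is_subgroup I /\ (forall a u b, I u -> I (a * u * b)).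

Definition additive_span (V : zmodType) (S : set V) : set V :=
  smallest (@is_subgroup V) S.

Definition ideal_gen (R : pzRingType) (S : set R) : set R :=
  smallest (@is_ideal2 R) S.

Lemma ideal_gen_is_ideal2 (R : pzRingType) (S : set R) :
  is_ideal2 (ideal_gen S).
Proof.
split; last by move=> a u b Iu J J_S; apply: J_S.1.2; apply: Iu.
split; first by move=> J [[[J0]]].
- by move=> u v Iu Iv J J_S; case: (J_S.1) => -[_ JD _] _; apply: JD;
    [apply: Iu | apply: Iv].
- by move=> u Iu J J_S; case: (J_S.1) => -[_ _ JN] _; apply: JN; apply: Iu.
Qed.

(* R/(S), the quotient of a possibly noncommutative ring by the two-sided
   ideal generated by S; the library only has the ring structure on such
   quotients for proper ideals of commutative rings.  Here the quotient may be
   the zero ring, whence pzRingType. *)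
Section QuotientRing.
Variables (R : pzRingType) (S : set R).

Definition ideal_gen_pred (x : R) : bool := `[< ideal_gen S x >].

Lemma ideal_gen_predE x : (x \in ideal_gen_pred) = `[< ideal_gen S x >].
Proof. by []. Qed.

Lemma ideal_gen_zmod_closed : zmod_closed ideal_gen_pred.
Proof.
have [[I0 ID IN] _] := ideal_gen_is_ideal2 S.
split=> [|x y]; rewrite !ideal_gen_predE; first exact/asboolP.
by move=> /asboolP Ix /asboolP Iy; apply/asboolP; apply: (ID _ _ Ix (IN _ Iy)).
Qed.

HB.instance Definition _ :=
  GRing.isZmodClosed.Build R ideal_gen_pred ideal_gen_zmod_closed.

Definition ideal_gen_closed : zmodClosed R :=
  GRing.ZmodClosed.clone R ideal_gen_pred _.

Definition quo : Type := Quotient.quot ideal_gen_closed.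

HB.instance Definition _ := GRing.Zmodule.on quo.
HB.instance Definition _ :
  EqQuotient R (Quotient.equiv ideal_gen_closed) quo := EqQuotient.on quo.

Definition quo_pi (x : R) : quo := \pi_quo%qT x.

Lemma quo_piP x y : quo_pi x = quo_pi y <-> ideal_gen S (x - y).
Proof.
rewrite /quo_pi; split=> [/eqP|Ixy].
  by rewrite -Quotient.idealrBE ideal_gen_predE => /asboolP.
by apply/eqP; rewrite -Quotient.idealrBE ideal_gen_predE; apply/asboolP.
Qed.

Lemma quo_reprK (x : quo) : quo_pi (repr x) = x.
Proof. exact: reprK. Qed.

Lemma quo_pi0 : quo_pi 0 = 0.
Proof. exact: pi_zeror. Qed.

Lemma quo_piN : {morph quo_pi : x / - x}.
Proof. exact: pi_oppr. Qed.

Lemma quo_piD : {morph quo_pi : x y / x + y}.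
Proof. exact: pi_addr. Qed.

Definition quo_one : quo := quo_pi 1.
Definition quo_mul (x y : quo) : quo := quo_pi (repr x * repr y).

Lemma quo_piM_subproof x y : quo_pi (x * y) = quo_mul (quo_pi x) (quo_pi y).
Proof.
have [[I0 ID IN] IM] := ideal_gen_is_ideal2 S.
apply/quo_piP; set x' := repr _; set y' := repr _.
have Ix : ideal_gen S (x - x') by apply/quo_piP; rewrite quo_reprK.
have Iy : ideal_gen S (y - y') by apply/quo_piP; rewrite quo_reprK.
have -> : x * y - x' * y' = 1 * (x - x') * y + x' * (y - y') * 1.
  by rewrite mul1r mulr1 mulrBl mulrBr addrA subrK.
by apply: ID; apply: IM.
Qed.

Lemma quo_mulA : associative quo_mul.
Proof.
move=> x y z; rewrite -[x]quo_reprK -[y]quo_reprK -[z]quo_reprK.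
by rewrite -!quo_piM_subproof mulrA.
Qed.

Lemma quo_mul1x : left_id quo_one quo_mul.
Proof. by move=> x; rewrite -[x]quo_reprK -quo_piM_subproof mul1r. Qed.

Lemma quo_mulx1 : right_id quo_one quo_mul.
Proof. by move=> x; rewrite -[x]quo_reprK -quo_piM_subproof mulr1. Qed.

Lemma quo_mulDl : left_distributive quo_mul +%R.
Proof.
move=> x y z; rewrite -[x]quo_reprK -[y]quo_reprK -[z]quo_reprK.
by rewrite -quo_piD -!quo_piM_subproof -quo_piD mulrDl.
Qed.

Lemma quo_mulDr : right_distributive quo_mul +%R.
Proof.
move=> x y z; rewrite -[x]quo_reprK -[y]quo_reprK -[z]quo_reprK.
by rewrite -quo_piD -!quo_piM_subproof -quo_piD mulrDr.
Qed.

HB.instance Definition _ := GRing.Zmodule_isPzRing.Build quo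
  quo_mulA quo_mul1x quo_mulx1 quo_mulDl quo_mulDr.

Lemma quo_pi_is_zmod_morphism : zmod_morphism quo_pi.
Proof. by move=> x y; rewrite quo_piD quo_piN. Qed.

Lemma quo_pi_is_monoid_morphism : monoid_morphism quo_pi.
Proof. by split=> // x y; rewrite quo_piM_subproof. Qed.

HB.instance Definition _ :=
  GRing.isZmodMorphism.Build R quo quo_pi quo_pi_is_zmod_morphism.
HB.instance Definition _ :=
  GRing.isMonoidMorphism.Build R quo quo_pi quo_pi_is_monoid_morphism.

End QuotientRing.

Section LowerCentralSeries.
Variable A : pzRingType.

Definition lie (a b : A) : A := a * b - b * a.

(* The series starts at L 1 = A; L 0 is a dummy value. *)
Fixpoint L (k : nat) : set A :=
  match k with
  | 0 | 1 => setT
  | j.+1 => additive_span [set x | exists a b, L j b /\ x = lie a b]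
  end.

Definition M (k : nat) : set A := ideal_gen (L k).

(* M_k/M_{k+1}, as a subgroup of A/M_{k+1} = quo (L k.+1). *)
Definition N (k : nat) : set (quo (L k.+1)) := quo_pi (L k.+1) @` M k.
Arguments N k _ : clear implicits.

(* The degree d part of N_k, for A graded by G; the quotient A/M_{k+1} is
   graded by the images of the G d. *)
Definition Ndeg (G : nat -> set A) (k d : nat) : set (quo (L k.+1)) :=
  N k `&` quo_pi (L k.+1) @` G d.

End LowerCentralSeries.
Arguments N {A} k _.
Arguments Ndeg {A} G k d _.

(* Rank of the subgroup H of V, as the largest cardinality of a Z-linearly
   independent family in H; has_rank H r fails for every r if H has infinite
   rank. *)
Section Rank.
Variable V : zmodType.

Definition Zfree (n : nat) (g : 'I_n -> V) : Prop :=
  forall c : 'I_n -> int, \sum_(i < n) g i *~ c i = 0 -> forall i, c i = 0.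

Definition has_rank (H : set V) (r : nat) : Prop :=
  (exists g : 'I_r -> V, (forall i, H (g i)) /\ Zfree g) /\
  (forall n (g : 'I_n -> V), (forall i, H (g i)) -> Zfree g -> (n <= r)%N).

End Rank.

(* Z<x,y>, the monoid ring of the free monoid of words on two letters. *)
Definition freeZ : nzRingType := malg (fmonom 'I_2) int.

Definition homogeneous (m : nat) (f : freeZ) : Prop :=
  forall w : fmonom 'I_2, monalg.mcoeff w f != 0 -> fdeg w = m.

(* f |-> f_ab : a word maps to the product of its letters. *)
Definition abel (f : freeZ) : {mpoly int[2]} :=
  monalg.mmap (fun c : int => c%:MP)
    (fun w : fmonom 'I_2 => \prod_(i <- w) 'X_i) f.

Definition alg (f : freeZ) : pzRingType := quo [set f].

Definition algdeg (f : freeZ) (d : nat) : set (alg f) :=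
  quo_pi [set f] @` homogeneous d.
Arguments algdeg f d _ : clear implicits.

Section LinearFactors.
Variable C : fieldType.

Definition linear_form (l : {mpoly C[2]}) : Prop :=
  l != 0 /\ exists a b : C, l = a *: 'X_0 + b *: 'X_1.

Definition linear_factors (p : {mpoly C[2]}) : set {mpoly C[2]} :=
  [set l | linear_form l /\ exists q, p = l * q].

Definition prop_class (l : {mpoly C[2]}) : set {mpoly C[2]} :=
  [set l' | exists2 c : C, c != 0 & l' = c *: l].

Definition has_nb_linear_factors (p : {mpoly C[2]}) (s : nat) : Prop :=
  (prop_class @` linear_factors p #= `I_s)%card.

End LinearFactors.

(* Main.v *)
From HB Require Import structures.
Require Import Defs.
From mathcomp Require Import all_boot all_order all_algebra all_field.
From mathcomp Require Import complex boolp classical_sets.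
From mathcomp Require Import cardinality reals.
From mathcomp Require Import -(notations) monalg.
From mathcomp Require Import mpoly.
From mathcomp Require Import ring zify.

(** Let F be the free ring on x and y, g the abelianization of f, omega the
    commutator [x,y], and Q the quotient of F by M_3(F) and f, so that N_2(A)
    is the ideal generated by omega in Q.

    In Q the element omega is central with square zero, so every a in F can be
    rewritten there with all letters x in front ([normal_form]):
    a = N(a_ab) - omega N(inv a).  Here N sends X^i Y^j to x^i y^j, and inv
    sends a word with i letters x and j letters y to its number of inversions
    times X^(i-1) Y^(j-1).  As inv (a b) = a_ab inv b + inv a b_ab
    + (d/dy a_ab) (d/dx b_ab), the ring F/M_3(F) is a first-order deformation
    of Z[X,Y].

    For q in Z[X,Y] the product omega N(q) vanishes in Q as soon as q is a
    multiple of g_x or g_y: the elements [f,y] and [x,f] vanish in Q, and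
    their normal forms are omega N(g_x) and omega N(g_y).  Conversely, if
    omega N(q) vanishes then q lies in the ideal (g, g_x, g_y): the elements a
    such that a_ab = u g and inv a is congruent to u inv f modulo (g, g_x, g_y),
    for some u, form a two-sided ideal of F that contains f and all triple
    commutators ([relation_ideal]).  By Euler's identity g is redundant over
    the rationals, so the rank of N_2(A)[d] is the dimension of the part of
    degree d - 2 of the rational polynomials modulo (g_x, g_y).

    Setting Y = 1 makes this a computation in one variable.  With
    gamma(t) = g(t,1), the part of degree d - 2 of (g_x, g_y) becomes the span
    of the t^i gamma' and the t^i (m gamma - t gamma') for i < d - m.  Division
    by gcd(gamma, gamma') leaves a coprime pair, so the relations among these
    polynomials are the multiples of one syzygy and the rank depends only on
    the larger of the two sizes in the pair ([rank_combinations_mx]).  That size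
    is s ([max_size_euler_pair], [nb_linear_factorsE]): gamma / gcd(gamma,
    gamma') has the roots of gamma as simple roots, and the remaining possible
    factor of g, namely Y, is present exactly when gamma has degree less
    than m.  Altogether the rank is, for d >= 1,
    (d - 1) - 2 (d - m)_+ + (d - m - s + 1)_+, which is the formula.  The case
    m = 0 is separate: then a nonzero integer annihilates A. *)

Set Implicit Arguments.
Unset Strict Implicit.
Unset Printing Implicit Defensive.

Import Order.TTheory GRing.Theory Num.Theory.
Local Open Scope ring_scope.

Local Notation P2 := {mpoly int[2]}.
Local Notation Dx := (@mderiv 2 _ 0).
Local Notation Dy := (@mderiv 2 _ 1).
Local Notation word := (fmonom 'I_2).
Local Notation term c w := (@monalg.mkmalgU (fmonom 'I_2) int w c : freeZ).
Local Notation ratmx A := (map_mx (intr : int -> rat) A).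
Local Notation ratp p := (map_poly (intr : int -> rat) p).

(** * Polynomials in two variables *)

Lemma mderivU (R : comNzRingType) n (i j : 'I_n) :
  ('X_j : {mpoly R[n]})^`M(i) = (j == i)%:R.
Proof.
rewrite mderivX mnm1E; case: eqP => [->|_]; last by rewrite scale0r.
rewrite scale1r -mpolyX0; congr 'X_[_].
by apply/mnmP => k; rewrite !(mnmE, mnm1E) subnn.
Qed.

Lemma ord2_lift0 : fintype.lift ord0 ord0 = 1 :> 'I_2.
Proof. exact/val_inj. Qed.

Lemma mpoly2_ind (P : P2 -> Prop) :
  P 0 -> (forall p q, P p -> P q -> P (p + q)) ->
  (forall c i j, P (c *: ('X_0 ^+ i * 'X_1 ^+ j))) -> forall p, P p.
Proof.
move=> P0 PD PX; elim/mpolyind => // c m p _ _ IH; apply: (PD) => //.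
have -> : 'X_[m] = 'X_0 ^+ m 0 * 'X_1 ^+ m 1 :> P2; last exact: PX.
by rewrite mpolyXE_id 2!big_ord_recl big_ord0 ord2_lift0 mulr1.
Qed.

Lemma dhomog_mderiv (R : comNzRingType) d (p : {mpoly R[2]}) i :
  p \is d.-homog -> p^`M(i) \is d.-1.-homog.
Proof.
move=> /dhomogP Hp; apply/dhomogP => m; rewrite mcoeff_msupp mcoeff_deriv => H.
have : (m + U_(i))%MM \in msupp p.
  by rewrite mcoeff_msupp; apply: contraNneq H => ->; rewrite mul0rn.
by move=> /Hp /= <-; rewrite /= mdegD mdeg1 addn1.
Qed.

Lemma dhomog2_ind (R : comNzRingType) d (P : {mpoly R[2]} -> Prop) : P 0 ->
  (forall p q, P p -> P q -> P (p + q)) ->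
  (forall c i, (i <= d)%N -> P (c *: ('X_0 ^+ i * 'X_1 ^+ (d - i)))) ->
  forall p, p \is d.-homog -> P p.
Proof.
move=> P0 PD PX p /dhomogP Hp; rewrite [p]mpolyE big_seq.
elim/big_ind: _ => // m /Hp /= mE.
have -> : 'X_[m] = 'X_0 ^+ m 0 * 'X_1 ^+ m 1 :> {mpoly R[2]}.
  by rewrite mpolyXE_id 2!big_ord_recl big_ord0 ord2_lift0 mulr1.
have {}mE : (m 0%R + m 1%R = d)%N.
  by rewrite -mE mdegE 2!big_ord_recl big_ord0 ord2_lift0 addn0.
by rewrite -(addKn (m 0) (m 1)) mE; apply: PX; rewrite -mE leq_addr.
Qed.

(** * Dehomogenization *)

Section Dehomogenization.
Variable R : comNzRingType.
Local Notation Dx := (@mderiv 2 R 0).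
Local Notation Dy := (@mderiv 2 R 1).
Implicit Types (p q : {mpoly R[2]}) (a b : {poly R}).

Definition dehom : {mpoly R[2]} -> {poly R} :=
  mpoly.mmap (@polyC R) (fun i => if i == 0 then 'X else 1).
HB.instance Definition _ := GRing.RMorphism.copy dehom
  (mpoly.mmap (@polyC R) (fun i => if i == 0 then 'X else 1)).

(** The inverse of [dehom] on forms of degree [k]; the sum has a fixed length
    so that the same [a] can be homogenized in any degree. *)
Definition homogen k a : {mpoly R[2]} :=
  \sum_(i < k.+1) a`_i *: ('X_0 ^+ i * 'X_1 ^+ (k - i)).

Lemma dehomX0 : dehom 'X_0 = 'X.
Proof. by rewrite /dehom mmapX mmap1U. Qed.

Lemma dehomX1 : dehom 'X_1 = 1.
Proof. by rewrite /dehom mmapX mmap1U. Qed.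

Lemma dehomZ c p : dehom (c *: p) = c *: dehom p.
Proof. by rewrite /dehom mmapZ mul_polyC. Qed.

Lemma dehom_mon i j : dehom ('X_0 ^+ i * 'X_1 ^+ j) = 'X^i.
Proof. by rewrite rmorphM !rmorphXn /= dehomX0 dehomX1 expr1n mulr1. Qed.

Lemma dehom_homogen k a : (size a <= k.+1)%N -> dehom (homogen k a) = a.
Proof.
move=> sa; rewrite /homogen raddf_sum -[RHS]coefK poly_def.
rewrite (big_ord_widen _ (fun i => a`_i *: 'X^i) sa) [RHS]big_mkcond /=.
apply: eq_bigr => i _; rewrite dehomZ dehom_mon.
by case: ltnP => // /(nth_default 0) ->; rewrite scale0r.
Qed.

Lemma homogenD k a b : homogen k (a + b) = homogen k a + homogen k b.
Proof.
by rewrite -big_split; apply: eq_bigr => i _; rewrite coefD scalerDl.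
Qed.

Lemma homogen0 k : homogen k 0 = 0.
Proof. by apply: big1 => i _; rewrite coef0 scale0r. Qed.

Lemma homogen_dehom k p : p \is k.-homog -> homogen k (dehom p) = p.
Proof.
elim/dhomog2_ind => [|{}p q Hp Hq|c i le_ik].
- by rewrite rmorph0 homogen0.
- by rewrite rmorphD homogenD Hp Hq.
rewrite dehomZ dehom_mon /homogen (bigD1 (Ordinal (le_ik : (i < k.+1)%N))) //=.
rewrite coefZ coefXn eqxx mulr1 big1 ?addr0 // => j ij.
by rewrite coefZ coefXn; move: ij; rewrite -val_eqE /= => /negPf ->;
  rewrite mulr0 scale0r.
Qed.

Lemma dhomog_homogen k a : homogen k a \is k.-homog.
Proof.
apply: rpred_sum => i _; apply: dhomogZ; rewrite !mpolyXn -mpolyXD dhomogX /=.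
by rewrite mdegD !mdegMn !mdeg1 !mul1n subnKC // -ltnS.
Qed.

Lemma size_dehom k p : p \is k.-homog -> (size (dehom p) <= k.+1)%N.
Proof.
elim/dhomog2_ind => [|{}p q Hp Hq|c i le_ik].
- by rewrite rmorph0 size_poly0.
- by rewrite rmorphD (leq_trans (size_polyD _ _)) // geq_max Hp.
rewrite dehomZ dehom_mon (leq_trans (size_scale_leq _ _)) //.
by rewrite size_polyXn.
Qed.

Lemma homogen_mul k l p q : p \is k.-homog -> q \is l.-homog ->
  homogen (k + l) (dehom p * dehom q) = p * q.
Proof. by move=> Hp Hq; rewrite -rmorphM homogen_dehom // dhomogM. Qed.

Lemma mpoly2_ring_ind (P : {mpoly R[2]} -> Prop) :
  (forall c, P c%:MP) -> (forall p q, P p -> P q -> P (p + q)) ->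
  (forall p, P p -> P ('X_0 * p)) -> (forall p, P p -> P ('X_1 * p)) ->
  forall p, P p.
Proof.
move=> PC PD PX PY p; rewrite [p]mpolyE; elim/big_ind: _ => //.
  by rewrite -(mpolyC0 2 R); apply: PC.
move=> m _; have -> : 'X_[m] = 'X_0 ^+ m 0 * 'X_1 ^+ m 1 :> {mpoly R[2]}.
  by rewrite mpolyXE_id 2!big_ord_recl big_ord0 ord2_lift0 mulr1.
elim: (m 0) => [|i IH]; last by rewrite exprS -mulrA scalerAr; apply: PX.
elim: (m 1) => [|i IH].
  by rewrite !expr0 mulr1 -mul_mpolyC mulr1; apply: PC.
by rewrite mul1r exprS scalerAr; apply: PY; rewrite -['X_1 ^+ i]mul1r.
Qed.

Lemma dehom_Dx p : dehom (Dx p) = (dehom p)^`().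
Proof.
elim/mpoly2_ring_ind: p => [c|p q Hp Hq|p Hp|p Hp].
- by rewrite mderivC rmorph0 /dehom mmapC derivC.
- by rewrite mderivD !rmorphD /= Hp Hq derivD.
- rewrite mderivM mderivU eqxx mul1r rmorphD !rmorphM /= dehomX0 derivM derivX.
  by rewrite Hp mul1r.
rewrite mderivM mderivU mul0r add0r !rmorphM /= dehomX1 !mul1r.
exact: Hp.
Qed.

Lemma mderiv_exp (i j : 'I_2) n :
  'X_j * ('X_j ^+ n : {mpoly R[2]})^`M(i) = (n * (j == i))%:R * 'X_j ^+ n.
Proof.
elim: n => [|n IH]; first by rewrite expr0 -mpolyC1 mderivC mulr0 mul0n mul0r.
rewrite exprS mderivM mderivU mulrDr IH mulSn natrD; ring.
Qed.

Lemma mderiv_exp0 (i j : 'I_2) n : j != i ->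
  ('X_j ^+ n : {mpoly R[2]})^`M(i) = 0.
Proof.
move=> /negPf ij; elim: n => [|n IH]; first by rewrite expr0 -mpolyC1 mderivC.
by rewrite exprS mderivM mderivU ij mul0r add0r IH mulr0.
Qed.

Lemma euler k p : p \is k.-homog -> 'X_0 * Dx p + 'X_1 * Dy p = k%:R * p.
Proof.
elim/dhomog2_ind => [|{}p q Hp Hq|c i le_ik].
- by rewrite !mderiv0 !mulr0 addr0.
- by rewrite !mderivD !mulrDr addrACA Hp Hq.
rewrite !mderivZ -!scalerAr -scalerDr; congr (_ *: _).
rewrite !mderivM (@mderiv_exp0 0 1) // (@mderiv_exp0 1 0) //.
transitivity (('X_0 * Dx ('X_0 ^+ i)) * 'X_1 ^+ (k - i)
  + 'X_0 ^+ i * ('X_1 * Dy ('X_1 ^+ (k - i)))); first by ring.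
rewrite !mderiv_exp /= !muln1 -[in k%:R](subnKC le_ik) natrD; ring.
Qed.

(** Euler's identity at Y = 1. *)
Lemma dehom_Dy k p : p \is k.-homog ->
  dehom (Dy p) = k%:R * dehom p - 'X * (dehom p)^`().
Proof.
move=> /euler /(congr1 dehom); rewrite rmorphD !rmorphM /= dehomX0 dehomX1.
by rewrite rmorph_nat mul1r dehom_Dx => <-; rewrite addrC addKr.
Qed.

(** Multiplication by a form of degree [m] shifts homogeneous components, which
    turns membership in an ideal generated by forms into membership with
    homogeneous cofactors. *)
Lemma pihomogM d m p q : q \is m.-homog ->
  pihomog mdeg d (p * q) = if (m <= d)%N then pihomog mdeg (d - m) p * q else 0.
Proof.
move=> Hq; elim/mpolyind: p => [|c mm p _ _ IH].
  by rewrite mul0r !pihomog0 mul0r if_same.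
rewrite mulrDl pihomogD IH pihomogD mulrDl !linearZ /= pihomogX.
rewrite -scalerAl linearZ /=.
have Hmm : 'X_[mm] * q \is (mdeg mm + m).-homog by rewrite dhomogM // dhomogX.
case: leqP => [le_md|lt_dm]; last first.
  rewrite addr0 (pihomog_ne0 _ Hmm) ?scaler0 //.
  by rewrite neq_ltn ltn_addl ?orbT.
congr (_ + _); rewrite -scalerAl; congr (_ *: _).
case: eqP => [E|E]; first by rewrite pihomog_dE // -(subnK le_md) -E.
rewrite mul0r (pihomog_ne0 _ Hmm) //.
by apply/eqP => E'; apply: E; rewrite -E' addnK.
Qed.

End Dehomogenization.

Lemma dehom_map (R S : comNzRingType) (h : {rmorphism R -> S}) p :
  dehom (map_mpoly h p) = map_poly h (dehom p).
Proof.
elim/mpoly2_ring_ind: p => [c|p q Hp Hq|p Hp|p Hp].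
- by rewrite map_mpolyC /dehom !mmapC map_polyC.
- by rewrite !rmorphD /= Hp Hq.
- by rewrite !rmorphM /= map_mpolyX !dehomX0 Hp map_polyX.
by rewrite !rmorphM /= map_mpolyX !dehomX1 rmorph1 !mul1r Hp.
Qed.

(** The generator [g] is kept because Euler's identity puts only a multiple of
    it in the ideal of the two partial derivatives. *)
Definition jacobian_ideal (g : P2) : set P2 :=
  [set q | exists p0 p1 p2, q = p0 * g + p1 * Dx g + p2 * Dy g]%classic.

(** The cofactors can be taken homogeneous, hence of bounded size after
    dehomogenization: this is where a membership in an ideal becomes a
    statement about a space of finite dimension. *)
Lemma jacobian_ideal_dehom m n (g q : P2) : (0 < m)%N -> g \is m.-homog ->
  q \is n.-homog -> jacobian_ideal g q -> exists a0 a1 a2 : {poly int},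
  [/\ (size a0 <= n.+1 - m)%N, (size a1 <= n.+2 - m)%N,
      (size a2 <= n.+2 - m)%N &
   dehom q = a0 * dehom g + a1 * (dehom g)^`()
             + a2 * (m%:R * dehom g - 'X * (dehom g)^`())].
Proof.
move=> m0 Hg Hq [p0 [p1 [p2 qE]]].
have HDx := dhomog_mderiv 0 Hg; have HDy := dhomog_mderiv 1 Hg.
pose h e p : {poly int} :=
  if (e <= n)%N then dehom (pihomog mdeg (n - e) p) else 0.
have hs e p : (size (h e p) <= n.+1 - e)%N.
  rewrite /h; case: (leqP e n) => [le_en|_]; last by rewrite size_poly0.
  by rewrite subSn // size_dehom // pihomogP.
exists (h m p0), (h m.-1 p1), (h m.-1 p2); split=> //.
- by rewrite (leq_trans (hs _ _)) // -[(n.+1 - _)%N]subSS prednK.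
- by rewrite (leq_trans (hs _ _)) // -[(n.+1 - _)%N]subSS prednK.
rewrite -(dehom_Dy Hg) -dehom_Dx -(pihomog_dE Hq) qE !pihomogD.
rewrite (pihomogM _ _ Hg) (pihomogM _ _ HDx) (pihomogM _ _ HDy) !rmorphD /h /=.
by case: ifP; case: ifP; rewrite ?rmorphM ?rmorph0 ?mul0r.
Qed.

(** * The abelianization and the inversion polynomial *)

Lemma freeZ_ind (P : freeZ -> Prop) :
  P 0 -> (forall a b, P a -> P b -> P (a + b)) -> (forall c w, P (term c w)) ->
  forall a, P a.
Proof.
move=> P0 PD PU a; rewrite [a]monalg.monalgE.
by elim/big_ind: _.
Qed.

Lemma termM c1 c2 w1 w2 :
  term c1 w1 * term c2 w2 = term (c1 * c2) (monalg.mmul w1 w2).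
Proof. by rewrite monalg.malgM_def monalg.fgmulUU. Qed.

Definition word_monomial (w : seq 'I_2) : P2 := \prod_(i <- w) 'X_i.

(** The number of pairs of a letter y followed by a later letter x, times the
    commutative monomial of the word divided by X Y.  Deleting a leading y
    loses one inversion for each remaining x, and that is what the partial
    derivative in X counts. *)
Fixpoint word_inversions (w : seq 'I_2) : P2 :=
  if w is i :: w' then
    'X_i * word_inversions w' + (i == 1)%:R * Dx (word_monomial w')
  else 0.

Lemma word_monomial_cat u v :
  word_monomial (u ++ v) = word_monomial u * word_monomial v.
Proof. exact: big_cat. Qed.

Lemma word_monomial_cons i w : word_monomial (i :: w) = 'X_i * word_monomial w.
Proof. exact: big_cons. Qed.

Lemma word_monomial_nil : word_monomial [::] = 1.
Proof. exact: big_nil. Qed.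

(** Inversions of a concatenation lie in one of the two words, or have their y
    in the first and their x in the second. *)
Lemma word_inversions_cat u v :
  word_inversions (u ++ v) =
  word_monomial u * word_inversions v + word_inversions u * word_monomial v
  + Dy (word_monomial u) * Dx (word_monomial v).
Proof.
elim: u => [|i u IH] /=.
  by rewrite word_monomial_nil -mpolyC1 mderivC mpolyC1 mul1r !mul0r !addr0.
rewrite IH word_monomial_cat mderivM !word_monomial_cons (mderivM 1) mderivU.
ring.
Qed.

Lemma mmap_additive (h : word -> P2) :
  zmod_morphism (monalg.mmap (fun c : int => c%:MP) h : freeZ -> P2).
Proof.
move=> a b.
exact: (@monalg.mmapB _ _ _ (@mpolyC 2 int) h).
Qed.

Lemma mmap_term (h : word -> P2) c w :
  monalg.mmap (fun c : int => c%:MP) h (term c w) = c%:MP * h w.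
Proof. exact: (@monalg.mmapU _ _ _ (@mpolyC 2 int)). Qed.

Definition inversions : freeZ -> P2 :=
  monalg.mmap (fun c : int => c%:MP) (fun w : word => word_inversions w).

HB.instance Definition _ :=
  GRing.isZmodMorphism.Build freeZ P2 inversions (mmap_additive _).
HB.instance Definition _ :=
  GRing.isZmodMorphism.Build freeZ P2 abel (mmap_additive _).

Lemma abel_term c w : abel (term c w) = c%:MP * word_monomial w.
Proof. exact: mmap_term. Qed.
Lemma inversions_term c w : inversions (term c w) = c%:MP * word_inversions w.
Proof. exact: mmap_term. Qed.

Lemma abel0 : abel 0 = 0.
Proof. exact: raddf0. Qed.

Lemma inversions0 : inversions 0 = 0.
Proof. exact: raddf0. Qed.

Lemma abelD a b : abel (a + b) = abel a + abel b.
Proof. exact: raddfD. Qed.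

Lemma inversionsD a b : inversions (a + b) = inversions a + inversions b.
Proof. exact: raddfD. Qed.

Lemma abelM a b : abel (a * b) = abel a * abel b.
Proof.
elim/freeZ_ind: a => [|a1 a2 H1 H2|c w].
- by rewrite mul0r abel0 mul0r.
- rewrite mulrDl (abelD a1) mulrDl; apply: (etrans (abelD _ _)).
  exact: congr2 H1 H2.
elim/freeZ_ind: b => [|a1 a2 H1 H2|c' w'].
- by rewrite mulr0 abel0 mulr0.
- rewrite mulrDr (abelD a1) mulrDr; apply: (etrans (abelD _ _)).
  exact: congr2 H1 H2.
rewrite termM !abel_term monalg.fmM word_monomial_cat mpolyCM; ring.
Qed.

Lemma abel1 : abel 1 = 1.
Proof.
rewrite [LHS](abel_term 1 monalg.mone) monalg.fm1 word_monomial_nil mulr1.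
exact: mpolyC1.
Qed.

HB.instance Definition _ :=
  GRing.isMonoidMorphism.Build freeZ P2 abel (conj abel1 abelM).

(** [inversions] is a Hochschild 2-cochain whose coboundary is the product of
    the derivations d/dy and d/dx. *)
Lemma inversionsM a b :
  inversions (a * b) =
  abel a * inversions b + inversions a * abel b + Dy (abel a) * Dx (abel b).
Proof.
elim/freeZ_ind: a => [|a1 a2 H1 H2|c w].
- by rewrite mul0r inversions0 abel0 mderiv0 !mul0r !addr0.
- rewrite mulrDl; apply: (etrans (inversionsD _ _)).
  apply: (etrans (congr2 _ H1 H2)).
  rewrite (inversionsD a1) (abelD a1) mderivD; ring.
elim/freeZ_ind: b => [|a1 a2 H1 H2|c' w'].
- by rewrite mulr0 inversions0 abel0 mderiv0 !mulr0 !addr0.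
- rewrite mulrDr; apply: (etrans (inversionsD _ _)).
  apply: (etrans (congr2 _ H1 H2)).
  rewrite (inversionsD a1) (abelD a1) mderivD; ring.
rewrite termM !abel_term !inversions_term monalg.fmM word_inversions_cat.
rewrite mpolyCM !mderiv_mulC.
ring.
Qed.

(** * Normal ordering modulo triple commutators *)

Section Lift.
Variables (F : nzRingType) (x y : F).

(** The section of the abelianization that puts x before y in each monomial. *)
Definition lift_normal : P2 -> F :=
  mpoly.mmap (intr : int -> F) (fun i => if i == 0 then x else y).
HB.instance Definition _ := GRing.Additive.copy lift_normal
  (mpoly.mmap (intr : int -> F) (fun i => if i == 0 then x else y)).

Lemma lift_normalD p q : lift_normal (p + q) = lift_normal p + lift_normal q.
Proof. exact: raddfD. Qed.

Lemma lift_normal_mon (c : int) i j :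
  lift_normal (c *: ('X_0 ^+ i * 'X_1 ^+ j)) = c%:~R * (x ^+ i * y ^+ j).
Proof.
rewrite /lift_normal mmapZ !mpolyXn -mpolyXD mmapX; congr (_ * _).
rewrite /mmap1 2!big_ord_recl big_ord0 ord2_lift0 /= mulr1.
by rewrite !(mnmDE, mulmnE, mnm1E) /= !(mul1n, mul0n, addn0, add0n).
Qed.

Lemma lift_normal_mulX p : lift_normal ('X_0 * p) = x * lift_normal p.
Proof.
elim/mpoly2_ind: p => [|p q Hp Hq|c i j].
- by rewrite mulr0 raddf0 mulr0.
- by rewrite mulrDr !lift_normalD Hp Hq mulrDr.
rewrite -scalerAr mulrA -exprS !lift_normal_mon exprS.
by rewrite !mulrA mulrzl mulrzr.
Qed.

End Lift.

(** The abelianization [ab] and the inversion polynomial [iv] enter only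
    through their product rules and their values on x and y. *)
Section NormalOrder.
Variables (F : nzRingType) (ab : {rmorphism F -> P2}) (iv : {additive F -> P2}).
Variables (x y : F).
Hypothesis ivM : forall a b,
  iv (a * b) = ab a * iv b + iv a * ab b + Dy (ab a) * Dx (ab b).
Hypotheses (abx : ab x = 'X_0) (aby : ab y = 'X_1).
Hypotheses (ivx : iv x = 0) (ivy : iv y = 0).

Lemma ab_lift p : ab (lift_normal x y p) = p.
Proof.
elim/mpoly2_ind: p => [|p q Hp Hq|c i j].
- by rewrite !raddf0.
- by rewrite lift_normalD rmorphD /= Hp Hq.
rewrite lift_normal_mon !(rmorphM, rmorphXn, rmorph_int) /= abx aby.
by rewrite mulrzl -scaler_int intz.
Qed.

Lemma ab_lie a b : ab (lie a b) = 0.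
Proof. by rewrite /lie rmorphB !rmorphM /= mulrC subrr. Qed.

Lemma iv_lie a b :
  iv (lie a b) = Dy (ab a) * Dx (ab b) - Dy (ab b) * Dx (ab a).
Proof. rewrite /lie raddfB /= !ivM; ring. Qed.

(** The abelianization of a commutator is zero, so triple commutators are
    invisible to both [ab] and [iv]. *)
Lemma iv_lie_lie a b c : iv (lie a (lie b c)) = 0.
Proof. by rewrite iv_lie ab_lie !mderiv0 mulr0 mul0r subrr. Qed.

Lemma iv1 : iv 1 = 0.
Proof.
have := ivM 1 1; rewrite mulr1 rmorph1 -mpolyC1 !mderivC mulr0 addr0 mpolyC1.
by rewrite mul1r mulr1 => /(congr1 (fun p => p - iv 1)); rewrite addrK subrr.
Qed.

Variables (Q : pzRingType) (pi : {rmorphism F -> Q}).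
Hypothesis pi_lie_lie : forall a b c, pi (lie a (lie b c)) = 0.
Local Notation W := (pi (lie x y)).
Local Notation L p := (pi (lift_normal x y p)).

Lemma central_lie a b c : pi a * pi (lie b c) = pi (lie b c) * pi a.
Proof.
by apply/eqP; rewrite -!rmorphM -subr_eq0 -rmorphB; apply/eqP/pi_lie_lie.
Qed.

(** [x y, y] equals omega y, and commuting it with x gives omega^2. *)
Lemma omega_sqr0 : W * W = 0.
Proof.
have := pi_lie_lie x (x * y) y.
have -> : lie (x * y) y = lie x y * y by rewrite /lie mulrBl mulrA.
rewrite {1}/lie rmorphB !rmorphM mulrA (central_lie x x y).
by rewrite -!mulrA -mulrBr {2}/lie rmorphB !rmorphM.
Qed.

Lemma pi_liftD p q : L (p + q) = L p + L q.
Proof. by rewrite lift_normalD rmorphD. Qed.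

Lemma pi_liftN p : L (- p) = - L p.
Proof. by rewrite -(rmorphN pi); congr (pi _); apply: raddfN. Qed.

(** Moving y to the right past x^i costs i copies of omega. *)
Lemma y_mul_lift p : pi y * L p = L ('X_1 * p) - W * L (Dx p).
Proof.
elim/mpoly2_ind: p => [|p q Hp Hq|c i j].
- by rewrite mulr0 mderiv0 !raddf0 !mulr0 subr0.
- rewrite mulrDr mderivD !pi_liftD !mulrDr Hp Hq opprD.
  exact: addrACA.
have Dy0 k : Dx ('X_1 ^+ k : P2) = 0.
  elim: k => [|k IH]; first by rewrite expr0 -mpolyC1 mderivC.
  rewrite exprS mderivM IH mulr0 addr0 mderivX mnm1E /=.
  by rewrite scale0r mul0r.
elim: i => [|i IH].
  rewrite mderivZ mderivM Dy0 mulr0 addr0 expr0 -mpolyC1 mderivC mul0r scaler0.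
  rewrite [lift_normal _ _ 0]raddf0 rmorph0 mulr0 subr0 -rmorphM; congr (pi _).
  rewrite mpolyC1 mul1r -scalerAr -exprS.
  rewrite -['X_1 ^+ j]mul1r -['X_1 ^+ j.+1]mul1r -(expr0 'X_0) !lift_normal_mon.
  by rewrite !expr0 !mul1r exprS !mulrA mulrzl mulrzr.
rewrite exprS -mulrA scalerAr; move: (_ *: _) IH => p IH.
rewrite lift_normal_mulX mderivM mderivU mul1r rmorphM mulrA.
have -> : pi y * pi x = pi x * pi y - W.
  by rewrite /lie rmorphB !rmorphM opprB addrC subrK.
rewrite mulrBl -mulrA IH mulrBr -rmorphM -lift_normal_mulX.
rewrite pi_liftD (lift_normal_mulX _ _ (Dx p)) rmorphM mulrDr !mulrA.
rewrite central_lie.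
by rewrite (mulrC 'X_1) opprD addrA addrAC.
Qed.

Lemma normal_formX a :
  pi a = L (ab a) - W * L (iv a) ->
  pi (x * a) = L (ab (x * a)) - W * L (iv (x * a)).
Proof.
move=> IH; rewrite [LHS]rmorphM /= IH ivM rmorphM /= abx ivx mul0r addr0.
have -> : Dy ('X_0 : P2) = 0 by rewrite mderivU.
rewrite mul0r addr0 !lift_normal_mulX !rmorphM /= mulrBr.
by rewrite mulrA central_lie mulrA.
Qed.

Lemma normal_formY a :
  pi a = L (ab a) - W * L (iv a) ->
  pi (y * a) = L (ab (y * a)) - W * L (iv (y * a)).
Proof.
move=> IH; rewrite [LHS]rmorphM /= IH ivM rmorphM /= aby ivy mul0r addr0.
rewrite mderivU mul1r mulrBr y_mul_lift mulrA central_lie -mulrA y_mul_lift.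
by rewrite mulrBr [W * (W * _)]mulrA omega_sqr0 mul0r subr0 pi_liftD mulrDr
  opprD addrA addrAC.
Qed.

Hypothesis gen_ind : forall P : F -> Prop, P 1 ->
  (forall a b, P a -> P b -> P (a - b)) ->
  (forall a, P a -> P (x * a)) -> (forall a, P a -> P (y * a)) ->
  forall a, P a.

(** Modulo triple commutators an element is determined by its abelianization
    and its inversion polynomial. *)
Lemma normal_form a : pi a = L (ab a) - W * L (iv a).
Proof.
elim/gen_ind: a => [|a b IHa IHb||].
- rewrite iv1 [lift_normal _ _ 0]raddf0 rmorph0 mulr0 subr0 (rmorph1 ab).
  have := lift_normal_mon x y 1 0 0; rewrite !expr0 !mulr1 scale1r => ->.
  by rewrite !rmorph1.
- rewrite rmorphB IHa IHb (rmorphB ab) (raddfB iv).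
  rewrite !(pi_liftD, pi_liftN) mulrDr mulrN.
  by rewrite !opprD !opprK addrACA.
- exact: normal_formX.
- exact: normal_formY.
Qed.

(** If the abelianization of [c] vanishes, the normal form of a multiple of [c]
    is a multiple of omega; so [c] yields relations on the multiples of
    omega. *)
Lemma omega_lift_iv c p : pi c = 0 -> ab c = 0 -> W * L (iv c * p) = 0.
Proof.
move=> c0 abc; have := normal_form (c * lift_normal x y p).
rewrite [pi (c * _)]rmorphM c0 mul0r ivM (rmorphM ab) abc ab_lift mderiv0.
rewrite !mul0r add0r addr0 [lift_normal _ _ 0]raddf0 rmorph0 sub0r.
by move/esym/eqP; rewrite oppr_eq0 => /eqP.
Qed.

(** Apply the preceding lemma to [g,y], whose inversion polynomial is
    - d/dx g. *)
Lemma omega_lift_Dx g p : pi g = 0 -> W * L (Dx (ab g) * p) = 0.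
Proof.
move=> g0; have := @omega_lift_iv (lie g y) (- p).
rewrite {1}/lie rmorphB !rmorphM g0 mulr0 mul0r subrr ab_lie iv_lie aby.
by rewrite !mderivU /= mulr0 sub0r mul1r mulrNN; apply.
Qed.

(** Here the commutator is [x,g], whose inversion polynomial is
    - d/dy g. *)
Lemma omega_lift_Dy g p : pi g = 0 -> W * L (Dy (ab g) * p) = 0.
Proof.
move=> g0; have := @omega_lift_iv (lie x g) (- p).
rewrite {1}/lie rmorphB !rmorphM g0 mulr0 mul0r subrr ab_lie iv_lie abx.
by rewrite !mderivU /= mul0r sub0r mulr1 mulrNN; apply.
Qed.

End NormalOrder.

(** * Which elements vanish in the quotient *)

Section QuotientLie.
Variables (R : pzRingType) (f : R).
Local Notation A := (quo [set f]).

(** The projection of R onto the quotient of A = R/(f) by M_3(A). *)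
Definition quo_lie3 : R -> quo (L (A := A) 3) :=
  quo_pi (L (A := A) 3) \o quo_pi [set f].
HB.instance Definition _ := GRing.RMorphism.on quo_lie3.

Lemma quo_pi_lie (a b : R) :
  quo_pi [set f] (lie a b) = lie (quo_pi [set f] a) (quo_pi [set f] b).
Proof. by rewrite /lie rmorphB !rmorphM. Qed.

Lemma L2_lie (a b : A) : L 2 (lie a b).
Proof. by move=> H [_ sub]; apply: sub; exists a, b. Qed.

Lemma quo_lie3_f : quo_lie3 f = 0.
Proof.
rewrite /quo_lie3 /=.
have -> : quo_pi [set f] f = 0.
  by rewrite -quo_pi0; apply/quo_piP; rewrite subr0 => I [_]; apply.
exact: quo_pi0.
Qed.

Lemma quo_lie3_lie_lie (a b c : R) : quo_lie3 (lie a (lie b c)) = 0.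
Proof.
rewrite /quo_lie3 /= !quo_pi_lie -quo_pi0; apply/quo_piP; rewrite subr0.
move=> I [_]; apply => H [_]; apply.
by exists (quo_pi [set f] a), (lie (quo_pi [set f] b) (quo_pi [set f] c));
  split=> //; apply: L2_lie.
Qed.

Lemma image_is_subgroup (I : set R) :
  is_subgroup I -> is_subgroup (quo_pi [set f] @` I)%classic.
Proof.
move=> [I0 ID IN]; split.
- by exists 0 => //; exact: rmorph0.
- move=> _ _ [a Ia <-] [b Ib <-]; exists (a + b); first exact: ID.
  exact: rmorphD.
- by move=> _ [a Ia <-]; exists (- a); [exact: IN | exact: rmorphN].
Qed.

Lemma image_is_ideal2 (I : set R) :
  is_ideal2 I -> is_ideal2 (quo_pi [set f] @` I)%classic.
Proof.
move=> [I_sub I_mul]; split; first exact: image_is_subgroup.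
move=> a _ b [c Ic <-]; exists (repr a * c * repr b); first exact: I_mul.
by rewrite !rmorphM /= !quo_reprK.
Qed.

Variable I : set R.
Hypothesis I_ideal : is_ideal2 I.

Lemma M2_sub_image : (forall a b, I (lie a b)) ->
  (M (A := A) 2 `<=` quo_pi [set f] @` I)%classic.
Proof.
move=> I_lie v; apply; split; first exact: image_is_ideal2.
move=> w; apply; split; first exact: (image_is_ideal2 I_ideal).1.
move=> _ [a [b [_ ->]]]; exists (lie (repr a) (repr b)) => //.
by rewrite quo_pi_lie !quo_reprK.
Qed.

Hypothesis If : I f.

Lemma quo_pi_image a : (quo_pi [set f] @` I)%classic (quo_pi [set f] a) -> I a.
Proof.
have [[I0 ID IN] _] := I_ideal.
move=> [b Ib /quo_piP ba]; rewrite -[a](subrK b) addrC; apply: ID => //.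
by rewrite -opprB; apply: IN; apply: ba; split=> // _ ->.
Qed.

(** A two-sided ideal that contains [f] and all triple commutators contains the
    kernel; exhibiting such ideals is the way to bound the kernel from above. *)
Lemma quo_lie3_eq0 : (forall a b c, I (lie a (lie b c))) ->
  forall a, quo_lie3 a = 0 -> I a.
Proof.
move=> I_lie a; rewrite -(quo_pi0 (L (A := A) 3)) => /quo_piP.
rewrite subr0 => a3; apply: quo_pi_image; apply: a3; split.
  exact: image_is_ideal2.
have [[I0 ID IN] _] := I_ideal.
move=> w; apply; split; first exact: (image_is_ideal2 I_ideal).1.
move=> _ [c [z [Lz ->]]].
have [b Kb <-] : (quo_pi [set f] @` [set b | forall a, I (lie a b)])%classic z.
  apply: Lz; split.
    apply: image_is_subgroup; split=> [a'|u v Hu Hv a'|u Hu a'] /=.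
    - by rewrite /lie mulr0 mul0r subrr.
    - rewrite /lie mulrDr mulrDl opprD addrACA.
      by apply: ID; [exact: Hu | exact: Hv].
    - by rewrite /lie mulrN mulNr -opprD; apply: IN; exact: Hu.
  move=> _ [a1 [a2 [_ ->]]]; exists (lie (repr a1) (repr a2)) => //=.
  by rewrite quo_pi_lie !quo_reprK.
by exists (lie (repr c) b) => //; rewrite quo_pi_lie quo_reprK.
Qed.

End QuotientLie.

Section Kernel.
Variables (F : nzRingType) (ab : {rmorphism F -> P2}) (iv : {additive F -> P2}).
Variables (x y : F).
Hypothesis ivM : forall a b,
  iv (a * b) = ab a * iv b + iv a * ab b + Dy (ab a) * Dx (ab b).
Hypotheses (abx : ab x = 'X_0) (aby : ab y = 'X_1).
Variable f : F.
Local Notation g := (ab f).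

(** An upper bound for the ideal generated by [f] and the triple commutators,
    read on the pair of the abelianization and the inversion polynomial: a
    multiple of [f] has the pair (u g, u inv f) up to the Jacobian ideal. *)
Definition relation_ideal : set F := [set a | exists u,
  ab a = u * g /\ jacobian_ideal g (iv a - u * iv f)]%classic.

(** In the inversion polynomial of a c b the derivatives of a multiple u g
    of [g] are combinations of [g] and its partial derivatives, so the error
    terms stay in the Jacobian ideal. *)
Lemma relation_ideal_ideal2 : is_ideal2 relation_ideal.
Proof.
split; first split.
- exists 0; rewrite !raddf0 !mul0r subr0; split=> //.
  by exists 0, 0, 0; rewrite !mul0r !addr0.
- move=> a b [u [au [p0 [p1 [p2 Ha]]]]] [v [bv [q0 [q1 [q2 Hb]]]]].
  exists (u + v); split; first by rewrite rmorphD /= au bv mulrDl.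
  exists (p0 + q0), (p1 + q1), (p2 + q2); rewrite raddfD /= mulrDl.
  transitivity ((iv a - u * iv f) + (iv b - v * iv f)); first by ring.
  by rewrite Ha Hb; ring.
- move=> a [u [au [p0 [p1 [p2 Ha]]]]].
  exists (- u); split; first by rewrite rmorphN /= au mulNr.
  exists (- p0), (- p1), (- p2); rewrite raddfN /=.
  transitivity (- (iv a - u * iv f)); first by ring.
  by rewrite Ha; ring.
move=> a c b [u [cu [p0 [p1 [p2 Hc]]]]].
exists (ab a * u * ab b); split.
  by rewrite !rmorphM /= cu; ring.
rewrite !ivM rmorphM /= cu.
have {Hc} -> : iv c = u * iv f + (p0 * g + p1 * Dx g + p2 * Dy g).
  by rewrite -Hc addrC subrK.
rewrite !mderivM.
(* Besides the cofactors of c, these collect the derivatives of u g produced by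
   the two product rules. *)
exists (ab a * p0 * ab b + ab a * u * iv b + iv a * u * ab b
        + Dy (ab a) * Dx u * ab b + Dy (ab a) * u * Dx (ab b)
        + ab a * Dy u * Dx (ab b)),
  (ab a * p1 * ab b + Dy (ab a) * u * ab b),
  (ab a * p2 * ab b + ab a * u * Dx (ab b)).
ring.
Qed.

Local Notation pi := (quo_lie3 f).

Lemma quo_lie3_relation a : pi a = 0 -> relation_ideal a.
Proof.
apply: quo_lie3_eq0; first exact: relation_ideal_ideal2.
  exists 1; rewrite !mul1r subrr; split=> //.
  by exists 0, 0, 0; rewrite !mul0r !addr0.
move=> {}a b c; exists 0; rewrite (ab_lie ab a) (iv_lie_lie ivM) !mul0r subrr.
by split=> //; exists 0, 0, 0; rewrite !mul0r !addr0.
Qed.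

(** The abelianization of this element is zero and [g] is not, so the
    multiplier of [f] in [relation_ideal] vanishes and what remains of the
    inversion polynomial, namely - q, is in the Jacobian ideal. *)
Lemma omega_lift_eq0 q : g != 0 -> pi (lie x y * lift_normal x y q) = 0 ->
  jacobian_ideal g q.
Proof.
move=> g0 /quo_lie3_relation [u []].
rewrite rmorphM /= ab_lie mul0r => /esym/eqP; rewrite mulf_eq0 (negPf g0) orbF.
move=> /eqP-> [p0 [p1 [p2]]]; rewrite mul0r subr0 ivM ab_lie mderiv0 !mul0r.
rewrite (iv_lie ivM) abx aby !mderivU /= (ab_lift abx aby) => H.
exists (- p0), (- p1), (- p2); rewrite !mulNr -!opprD -H; ring.
Qed.

(** Elements of M_2 have zero abelianization, up to (f). *)
Lemma N2_ab a : N (A := quo [set f]) 2 (pi a) -> exists u, ab a = u * g.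
Proof.
move=> [v Mv vE].
have [b /= b0 bE] : (quo_pi [set f] @` [set b | ab b = 0])%classic v.
  apply: M2_sub_image Mv => [|a1 a2]; last exact: ab_lie.
  split; first split=> /= [|a1 a2 a1_0 a2_0|a1 a1_0].
  - exact: rmorph0.
  - by rewrite rmorphD /= a1_0 a2_0 addr0.
  - by rewrite rmorphN /= a1_0 oppr0.
  by move=> a1 a2 a3 /= a20; rewrite !rmorphM /= a20 mulr0 mul0r.
have /quo_lie3_relation [u [+ _]] : pi (b - a) = 0.
  by rewrite rmorphB /= -vE -bE subrr.
rewrite rmorphB /= b0 sub0r => /eqP; rewrite eqr_oppLR => /eqP ->.
by exists (- u); rewrite mulNr.
Qed.

End Kernel.

(** * Homogeneous elements of the free ring *)

Definition letter (i : 'I_2) : freeZ := term 1 (monalg.fmu i).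

Lemma abel_letter i : abel (letter i) = 'X_i.
Proof.
by rewrite abel_term mpolyC1 mul1r monalg.fmU /word_monomial big_seq1.
Qed.

Lemma inversions_letter i : inversions (letter i) = 0.
Proof.
rewrite inversions_term mpolyC1 mul1r monalg.fmU /= mulr0 add0r.
by rewrite word_monomial_nil -mpolyC1 mderivC mulr0.
Qed.

Lemma freeZ_letter_ind (P : freeZ -> Prop) : P 1 ->
  (forall a b, P a -> P b -> P (a - b)) ->
  (forall a, P a -> P (letter 0 * a)) -> (forall a, P a -> P (letter 1 * a)) ->
  forall a, P a.
Proof.
move=> P1 PB PX PY.
have P0 : P 0 by rewrite -(subrr 1); apply: PB.
have PN a : P a -> P (- a) by rewrite -sub0r; apply: PB.
have PD a b : P a -> P b -> P (a + b).
  by move=> Pa Pb; rewrite -[b]opprK; apply: (PB) => //; apply: PN.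
elim/freeZ_ind => // c w.
have Pw : P (term 1 w).
  rewrite -[w]monalg.fmK; elim: (w : seq _) => [|i s IH].
    by rewrite -monalg.fmoneE.
  have -> : term 1 (monalg.FMonom (i :: s)) =
      letter i * term 1 (monalg.FMonom s).
    rewrite /letter termM mulr1; congr (monalg.mkmalgU _ _).
    by apply/val_inj; rewrite /= monalg.fmM monalg.fmU.
  case: i => [[|[|//]]] lti.
    by rewrite (_ : Ordinal lti = 0); [exact: PX | exact/val_inj].
  by rewrite (_ : Ordinal lti = 1); [exact: PY | exact/val_inj].
have Pn (n : nat) : P (term n%:Z w).
  elim: n => [|n IH]; first by rewrite monalg.monalgU0.
  by rewrite -[n.+1]addn1 PoszD monalg.monalgUD; apply: PD.
case: c => n; first exact: Pn.
rewrite NegzE monalg.monalgUN; apply: PN; exact: Pn.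
Qed.

Lemma homogeneous0 d : homogeneous d 0.
Proof. by move=> w; rewrite monalg.mcoeff0 eqxx. Qed.

Lemma homogeneousD d a b :
  homogeneous d a -> homogeneous d b -> homogeneous d (a + b).
Proof.
move=> Ha Hb w; rewrite monalg.mcoeffD.
have [->|a0 _] := eqVneq (monalg.mcoeff w a) 0; last exact: Ha.
by rewrite add0r; apply: Hb.
Qed.

Lemma homogeneousN d a : homogeneous d a -> homogeneous d (- a).
Proof. by move=> Ha w; rewrite monalg.mcoeffN oppr_eq0; apply: Ha. Qed.

Lemma homogeneousMz d a c : homogeneous d a -> homogeneous d (a *~ c).
Proof.
move=> Ha; have Hn n : homogeneous d (a *+ n).
  elim: n => [|n IH]; first exact: homogeneous0.
  by rewrite mulrS; apply: homogeneousD.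
by case: c => n; rewrite ?NegzE ?mulrNz; [|apply: homogeneousN]; apply: Hn.
Qed.

Lemma homogeneous_term c (w : word) : homogeneous (size w) (term c w).
Proof.
by move=> w'; rewrite monalg.mcoeffU; case: (eqVneq w w') => [<- //|_];
  rewrite mulr0n eqxx.
Qed.

Lemma homogeneous_sum d (I : eqType) (r : seq I) (G : I -> freeZ) :
  (forall i, i \in r -> homogeneous d (G i)) ->
  homogeneous d (\sum_(i <- r) G i).
Proof.
move=> H; rewrite big_seq; elim/big_ind: _ => [|a b|i /H //].
  exact: homogeneous0.
exact: homogeneousD.
Qed.

Lemma homogeneousM d e a b :
  homogeneous d a -> homogeneous e b -> homogeneous (d + e) (a * b).
Proof.
move=> Ha Hb; rewrite [_ * _]monalg.malgME.
apply: homogeneous_sum => u; rewrite -monalg.mcoeff_neq0 => /Ha <-.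
apply: homogeneous_sum => v; rewrite -monalg.mcoeff_neq0 => /Hb <-.
by rewrite -monalg.fdegM; apply: homogeneous_term.
Qed.

Lemma homogeneous_ind d (P : freeZ -> Prop) : P 0 ->
  (forall a b, P a -> P b -> P (a + b)) ->
  (forall c w, size (w : word) = d -> P (term c w)) ->
  forall a, homogeneous d a -> P a.
Proof.
move=> P0 PD PU a Ha; rewrite [a]monalg.monalgE big_seq.
elim/big_ind: _ => // w; rewrite -monalg.mcoeff_neq0 => /Ha; exact: PU.
Qed.

Lemma dhomog_word_monomial w : word_monomial w \is (size w).-homog.
Proof.
elim: w => [|i w IH]; first by rewrite word_monomial_nil dhomog1.
rewrite word_monomial_cons -[(size _)]/(1 + size w)%N dhomogM //.
by rewrite dhomogX /= mdeg1.
Qed.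

Lemma homogeneous_abel d a : homogeneous d a -> abel a \is d.-homog.
Proof.
elim/homogeneous_ind => [|{}a b|c w <-]; first by rewrite abel0 dhomog0.
  by rewrite abelD; apply: dhomogD.
by rewrite abel_term mul_mpolyC dhomogZ // dhomog_word_monomial.
Qed.

Lemma dhomog_word_inversions w :
  word_inversions w \is (size w - 2).-homog /\
  ((size w < 2)%N -> word_inversions w = 0).
Proof.
elim: w => [|i w [IH IH0]] /=; first by rewrite dhomog0.
case: w => [|j w] in IH IH0 *.
  by rewrite /= word_monomial_nil -mpolyC1 mderivC !mulr0 addr0 dhomog0.
split=> //; move: (j :: w) IH IH0 (ltn0Sn (size w) : 0 < size (j :: w))%N.
move=> {j}w IH IH0 w0; rewrite subSS; apply: dhomogD.
  have [w1|w1] := ltnP (size w) 2; first by rewrite IH0 // mulr0 dhomog0.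
  have -> : (size w - 1 = 1 + (size w - 2))%N.
    by rewrite addnBA.
  by rewrite dhomogM // dhomogX /= mdeg1.
rewrite -scaler_nat -scalerAl mul1r subn1 dhomogZ //.
by rewrite dhomog_mderiv // dhomog_word_monomial.
Qed.

(** The truncated difference d - 2 says nothing for d < 2, where the inversion
    polynomial is zero because a single letter has no inversion. *)
Lemma homogeneous_inversions d a : homogeneous d a ->
  inversions a \is (d - 2).-homog /\ ((d < 2)%N -> inversions a = 0).
Proof.
elim/homogeneous_ind => [|{}a b [Ha Ha0] [Hb Hb0]|c w <-].
- by rewrite inversions0 dhomog0.
- rewrite inversionsD; split; first exact: dhomogD.
  by move=> d2; rewrite Ha0 // Hb0 // addr0.
rewrite inversions_term mul_mpolyC; have [Hw Hw0] := dhomog_word_inversions w.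
split; first exact: dhomogZ.
by move=> /Hw0 ->; rewrite scaler0.
Qed.

Lemma homogeneous1 : homogeneous 0 1.
Proof. by have := @homogeneous_term 1 monalg.mone; rewrite monalg.fm1. Qed.

Lemma homogeneousXn d a n : homogeneous d a -> homogeneous (n * d) (a ^+ n).
Proof.
move=> Ha; elim: n => [|n IH]; first by rewrite expr0; apply: homogeneous1.
by rewrite exprS mulSn; apply: homogeneousM.
Qed.

Lemma homogeneous_letter i : homogeneous 1 (letter i).
Proof. by have := @homogeneous_term 1 (monalg.fmu i); rewrite monalg.fmU. Qed.

Lemma homogeneous_lift_normal d p : p \is d.-homog ->
  homogeneous d (lift_normal (letter 0) (letter 1) p).
Proof.
elim/dhomog2_ind => [|{}p q Hp Hq|c i le_id].
- by rewrite raddf0; apply: homogeneous0.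
- by rewrite lift_normalD; apply: homogeneousD.
rewrite lift_normal_mon mulrzl; apply: homogeneousMz.
have := homogeneousM (@homogeneousXn 1 _ i (@homogeneous_letter 0))
  (@homogeneousXn 1 _ (d - i) (@homogeneous_letter 1)).
by rewrite !muln1 subnKC.
Qed.

Lemma homogeneous_lie_letters : homogeneous 2 (lie (letter 0) (letter 1)).
Proof.
by apply: homogeneousD; [|apply: homogeneousN]; apply: (@homogeneousM 1 1);
  apply: homogeneous_letter.
Qed.

(** * Ranks of quotients of lattices *)

(** The product of all denominators serves as a common denominator. *)
Lemma clear_denominators m n (A : 'M[rat]_(m, n)) :
  exists (D : int) (B : 'M[int]_(m, n)), D != 0 /\ D%:~R *: A = ratmx B.
Proof.
pose D := \prod_i \prod_j denq (A i j).
exists D, (\matrix_(i, j) numq (D%:~R * A i j)); split.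
  by apply/prodf_neq0 => i _; apply/prodf_neq0 => j _; apply: denq_neq0.
apply/matrixP => i j; rewrite !mxE numqK // /D (bigD1 i) //= (bigD1 j) //=.
set p := \prod_(_ | _) _; set q := \prod_(_ | _) _.
rewrite -mulrA mulrC rmorphM mulrA -numqE -rmorphM.
exact: intr_int.
Qed.

Lemma ratmx_inj m n : injective (fun B : 'M[int]_(m, n) => ratmx B).
Proof.
move=> B B' /matrixP BB'; apply/matrixP => i j; have := BB' i j.
by rewrite !mxE => /intr_inj.
Qed.

Section RankOfQuotient.
Variables (V : zmodType) (N l : nat) (th : {additive 'rV[int]_N -> V}).
Variables (H : set V) (M : 'M[int]_(l, N)).
Hypothesis H_th : forall c, H (th c).
Hypothesis th_onto : forall z, H z -> exists c, z = th c.
Hypothesis th_relation : forall w, th (w *m M) = 0.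
Hypothesis th_eq0 : forall c, th c = 0 -> (ratmx c <= ratmx M)%MS.

Lemma map_sum_row n (c : 'I_n -> int) (U : 'M[int]_(n, N)) :
  \sum_(i < n) th (row i U) *~ c i = th (\row_i c i *m U).
Proof.
rewrite mulmx_sum_row raddf_sum; apply: eq_bigr => i _.
have -> : (\row_i c i) 0 i *: row i U = row i U *~ c i.
  by rewrite mxE -scaler_int intz.
by rewrite raddfMz.
Qed.

(** H is Z^N modulo a group that contains the row lattice of M and is contained
    in its saturation, so its rank is N - rank M.  Integral multiples of a
    basis of a complement of the rational row space give an independent family
    of that size; an independent family in H lifts to rows that are
    independent modulo the row space of M. *)
Lemma has_rank_quotient : has_rank H (N - \rank (ratmx M)).
Proof.
split.
  rewrite -mxrank_compl.
  have [D [B [D0 BE]]] := clear_denominators (row_base (ratmx M)^C%MS).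
  exists (fun i => th (row i B)); split=> [i|c]; first exact: H_th.
  rewrite map_sum_row => /th_eq0; rewrite map_mxM -BE -scalemxAr => cM i.
  have cC : (ratmx (\row_i c i) *m row_base (ratmx M)^C <= (ratmx M)^C)%MS.
    by rewrite (submx_trans (submxMl _ _)) // eq_row_base.
  have {}cM : (ratmx (\row_i c i) *m row_base (ratmx M)^C <= ratmx M)%MS.
    by rewrite -(eqmx_scale _ (_ : D%:~R != 0)) ?intr_eq0.
  have : (ratmx (\row_i c i) *m row_base (ratmx M)^C <= (0 : 'M_N))%MS.
    by rewrite -(capmx_compl (ratmx M)) sub_capmx cM.
  rewrite submx0 mulmx_free_eq0 ?row_base_free // => /eqP/matrixP.
  by move=> /(_ 0 i); rewrite !mxE => /eqP; rewrite intr_eq0 => /eqP.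
move=> n g Hg g_free.
have /choice [u uE] : forall i, exists c, g i = th c.
  by move=> i; apply: th_onto.
pose U : 'M[int]_(n, N) := \matrix_i u i.
have gE i : g i = th (row i U) by rewrite rowK.
have key (v : 'rV[rat]_n) (w : 'rV[rat]_l) :
    v *m ratmx U = w *m ratmx M -> v = 0.
  move=> vw; have [D [B [D0 BE]]] := clear_denominators (row_mx v w).
  have vE : D%:~R *: v = ratmx (lsubmx B).
    by rewrite map_lsubmx -BE linearZ /= row_mxKl.
  have wE : D%:~R *: w = ratmx (rsubmx B).
    by rewrite map_rsubmx -BE linearZ /= row_mxKr.
  have UM : lsubmx B *m U = rsubmx B *m M.
    apply: ratmx_inj.
    by rewrite /= !map_mxM -vE -wE -!scalemxAl vw.
  have /g_free c0 : \sum_(i < n) g i *~ lsubmx B 0 i = 0.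
    under eq_bigr do rewrite gE.
    rewrite map_sum_row (_ : \row_i _ = lsubmx B) ?UM ?th_relation //.
    by apply/rowP => i; rewrite mxE.
  have B0 : lsubmx B = 0 by apply/rowP => i; rewrite c0 mxE.
  move/eqP: vE; rewrite B0 map_mx0 scaler_eq0 intr_eq0 (negPf D0).
  by move/eqP.
have Ufree : row_free (ratmx U).
  by apply: inj_row_free => v vU; apply: (key v 0); rewrite vU mul0mx.
have disj : (ratmx U :&: ratmx M)%MS = 0.
  apply/eqP/rowV0P => v; rewrite sub_capmx.
  move=> /andP[/submxP[a ->] /submxP[b abE]].
  by rewrite (key _ _ abE) mul0mx.
have := rank_leq_col (ratmx U + ratmx M)%MS.
rewrite mxrank_disjoint_sum // (eqP Ufree) => le_N.
by rewrite leq_subRL ?rank_leq_col // addnC.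
Qed.

End RankOfQuotient.

(** * The rank of the degree parts of an ideal with two generators *)

Section MultiplesMatrix.
Variable R : comNzRingType.
Implicit Types P Q : {poly R}.

Definition multiples_mx k N P : 'M[R]_(k, N) :=
  \matrix_(i < k) poly_rV ('X^i * P).

Lemma mul_multiples_mx k N P (w : 'rV_k) :
  w *m multiples_mx k N P = poly_rV (rVpoly w * P).
Proof.
rewrite mulmx_sum_row.
transitivity (\sum_i (w 0 i *: poly_rV ('X^i * P)) : 'rV_N).
  by apply: eq_bigr => i _; rewrite rowK.
rewrite /rVpoly poly_def mulr_suml linear_sum; apply: eq_bigr => i _.
by rewrite -scalerAl linearZ /= valK.
Qed.

Definition combinations_mx k N P Q : 'M[R]_(k + k, N) :=
  col_mx (multiples_mx k N P) (multiples_mx k N Q).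

Lemma mul_combinations_mx k N P Q (w : 'rV_(k + k)) :
  w *m combinations_mx k N P Q =
  poly_rV (rVpoly (lsubmx w) * P + rVpoly (rsubmx w) * Q).
Proof. by rewrite -{1}[w]hsubmxK mul_row_col !mul_multiples_mx linearD. Qed.

End MultiplesMatrix.

Lemma map_combinations_mx (R S : comNzRingType) (h : {rmorphism R -> S})
    k N P Q :
  map_mx h (combinations_mx k N P Q) =
  combinations_mx k N (map_poly h P) (map_poly h Q).
Proof.
rewrite map_col_mx; congr col_mx; apply/row_matrixP => i;
  by rewrite -map_row !rowK map_poly_rV rmorphM /= map_polyXn.
Qed.

(** By Bezout, if u p + v q = 1 then the factor is u b - v a. *)
Lemma syzygy_coprime (K : fieldType) (p q a b : {poly K}) : coprimep p q ->
  a * p + b * q = 0 -> exists c, a = - (c * q) /\ b = c * p.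
Proof.
move=> /Bezout_eq1_coprimepP[[u v] /= uv1] /eqP; rewrite addr_eq0 => /eqP apbq.
exists (u * b - v * a); split.
  transitivity (a * (u * p + v * q)); first by rewrite uv1 mulr1.
  by rewrite mulrDr mulrCA apbq; ring.
transitivity (b * (u * p + v * q)); first by rewrite uv1 mulr1.
transitivity (u * b * p + v * (b * q)); first by ring.
by rewrite -[b * q]opprK -apbq; ring.
Qed.

(** The two generators are written as multiples of their gcd [D].  The kernel
    of [combinations_mx] consists of the multiples of the syzygy (- q, p) by
    polynomials whose size is at most [kappa], the bound imposed by the larger
    of [p] and [q]. *)
Section PairRank.
Variables (K : fieldType) (D p q : {poly K}) (k N : nat).
Hypotheses (D0 : D != 0) (co_pq : coprimep p q).
Local Notation s := (maxn (size p) (size q)).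
Local Notation kappa := (k - (s - 1))%N.
Hypothesis sizeN :
  (size (p * D)%R + k <= N.+1)%N /\ (size (q * D)%R + k <= N.+1)%N.

Lemma size_syzygy (c : 'rV[K]_kappa) (r : {poly K}) :
  (size r <= s)%N -> (size (rVpoly c * r)%R <= k)%N.
Proof.
move=> sr; have sc : (size (rVpoly c) <= kappa)%N by apply: size_poly.
have [->|c0] := eqVneq (rVpoly c) 0; first by rewrite mul0r size_poly0.
have := size_polyMleq (rVpoly c) r.
rewrite -size_poly_gt0 in c0; lia.
Qed.

Lemma coprime_pair_neq0 : (p != 0) || (q != 0).
Proof.
rewrite -negb_and; apply/negP => /andP[/eqP p0 /eqP q0].
by move: co_pq; rewrite p0 q0 coprimep0 -size_poly_eq1 size_poly0.
Qed.

Lemma rank_combinations_mx :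
  \rank (combinations_mx k N (p * D) (q * D)) = (k + k - kappa)%N.
Proof.
pose Z : 'M[K]_(kappa, k + k) :=
  row_mx (multiples_mx kappa k (- q)) (multiples_mx kappa k p).
have mulZ c :
    c *m Z = row_mx (poly_rV (rVpoly c * - q)) (poly_rV (rVpoly c * p)).
  by rewrite mul_mx_row !mul_multiples_mx.
have sq (c : 'rV_kappa) : (size (rVpoly c * - q)%R <= k)%N.
  by rewrite size_syzygy // size_polyN leq_maxr.
have sp (c : 'rV_kappa) : (size (rVpoly c * p)%R <= k)%N.
  by rewrite size_syzygy // leq_maxl.
have ZM : Z *m combinations_mx k N (p * D) (q * D) = 0.
  apply/row_matrixP => i; rewrite row_mul rowE mulZ mul_combinations_mx row0.
  rewrite row_mxKl row_mxKr !poly_rV_K //.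
  by rewrite (_ : _ + _ = 0) ?linear0 //; ring.
have Zfree : row_free Z.
  apply: inj_row_free => c; rewrite mulZ => /eqP; rewrite row_mx_eq0 => /andP[].
  move=> /eqP/(congr1 (@rVpoly _ _)) + /eqP/(congr1 (@rVpoly _ _)).
  rewrite !poly_rV_K // !linear0 => /eqP; rewrite mulf_eq0 oppr_eq0 => cq /eqP.
  rewrite mulf_eq0 => cp; apply: (can_inj (@rVpolyK _ _)); rewrite linear0.
  by apply/eqP; case/orP: coprime_pair_neq0 cp cq => /negPf->; rewrite orbF.
have kerE : (kermx (combinations_mx k N (p * D) (q * D)) :=: Z)%MS.
  apply/eqmxP/andP; split; last exact/sub_kermxP.
  apply/row_subP => i; set v := row i _.
  have : v *m combinations_mx k N (p * D) (q * D) = 0.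
    by rewrite -row_mul mulmx_ker row0.
  rewrite mul_combinations_mx => /(congr1 (@rVpoly _ _)); rewrite linear0.
  set a := rVpoly (lsubmx v); set b := rVpoly (rsubmx v).
  have sa : (size a <= k)%N by apply: size_poly.
  have sb : (size b <= k)%N by apply: size_poly.
  have sN (r e : {poly K}) : (size r <= k)%N -> (size e + k <= N.+1)%N ->
      (size (r * e)%R <= N)%N.
    move=> sr se; have [->|r0] := eqVneq r 0; first by rewrite mul0r size_poly0.
    have := size_polyMleq r e; rewrite -size_poly_gt0 in r0; lia.
  case: sizeN => sN1 sN2.
  rewrite poly_rV_K; last first.
    by rewrite (leq_trans (size_polyD _ _)) // geq_max !sN.
  rewrite !mulrA -mulrDl => /eqP; rewrite mulf_eq0 (negPf D0) orbF => /eqP.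
  move=> /(syzygy_coprime co_pq)[c [aE bE]].
  have sc : (size c <= kappa)%N.
    have [->|c0] := eqVneq c 0; first by rewrite size_poly0.
    have c1 : (0 < size c)%N by rewrite size_poly_gt0.
    have scp : p != 0 -> (size c + size p <= k.+1)%N.
      by move=> p0; move: sb; rewrite bE size_mul // -subn1 leq_subLR add1n.
    have scq : q != 0 -> (size c + size q <= k.+1)%N.
      move=> q0; move: sa.
      by rewrite aE size_polyN size_mul // -subn1 leq_subLR add1n.
    have bound (u v' w : nat) : (0 < u)%N -> (0 < v')%N || (0 < w)%N ->
        ((0 < v')%N -> (u + v' <= k.+1)%N) ->
        ((0 < w)%N -> (u + w <= k.+1)%N) ->
        (u <= k - (maxn v' w - 1))%N by lia.
    by apply: bound; rewrite ?size_poly_gt0 // coprime_pair_neq0.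
  apply/submxP; exists (poly_rV c); rewrite mulZ poly_rV_K //.
  by rewrite mulrN -aE -bE !rVpolyK hsubmxK.
have := mxrank_ker (combinations_mx k N (p * D) (q * D)).
have := rank_leq_row (combinations_mx k N (p * D) (q * D)).
by rewrite kerE (eqP Zfree); lia.
Qed.

End PairRank.

(** * The square-free part of a polynomial *)

(** Throughout, [r] = g / gcd(g, g') is the square-free part of [g], and the
    pair (s, m r - X s) is what remains of (g', m g - X g') after division by
    gcd(g, g'). *)
Section SquareFreePart.
Variables (K : numFieldType) (g : {poly K}).
Hypothesis g0 : g != 0.
Local Notation D := (gcdp g g^`()).
Local Notation r := (g %/ gcdp g g^`()).
Local Notation s := (g^`() %/ gcdp g g^`()).

Lemma gcdp_deriv_neq0 : D != 0.
Proof. by rewrite gcdp_eq0 negb_and g0. Qed.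

Lemma sqfree_mul : g = r * D.
Proof. by rewrite divpK // dvdp_gcdl. Qed.

Lemma sqfree_deriv : g^`() = s * D.
Proof. by rewrite divpK // dvdp_gcdr. Qed.

Lemma sqfree_neq0 : r != 0.
Proof. by apply: contra_neq g0 => r0; rewrite sqfree_mul r0 mul0r. Qed.

(** A root of multiplicity n + 1 of [g] that is not a root of [r] would divide
    gcd(g, g'), hence g', with multiplicity n + 1; in characteristic zero the
    multiplicity in g' is n. *)
Lemma sqfree_root z : root r z = root g z.
Proof.
apply/idP/idP => [rz|gz]; first by rewrite sqfree_mul rootM rz.
apply: contraLR gz => rz.
have [n [q qz gE]] := multiplicity_XsubC g z; rewrite g0 /= in qz.
case: n => [|n] in gE *; first by rewrite gE mulr1.
have dvD : ('X - z%:P) ^+ n.+1 %| D.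
  have : ('X - z%:P) ^+ n.+1 %| r * D by rewrite -sqfree_mul gE dvdp_mull.
  by rewrite Gauss_dvdpr // coprimep_expl // coprimep_sym coprimep_XsubC.
have := dvdp_trans dvD (dvdp_gcdr _ _).
rewrite gE derivM dvdp_addr; last by rewrite dvdp_mull.
rewrite deriv_exp derivXsubC mul1r exprS -scaler_nat -!scalerAr.
rewrite dvdpZr ?pnatr_eq0 // dvdp_mul2r ?expf_neq0 ?polyXsubC_eq0 //.
by rewrite dvdp_XsubCl (negPf qz).
Qed.

Lemma size_deriv_char0 (p : {poly K}) : size p^`() = (size p).-1.
Proof.
have [->|p0] := eqVneq p 0; first by rewrite deriv0 size_poly0.
apply/anti_leq/andP; split.
  by rewrite -ltnS prednK ?size_poly_gt0 // lt_size_deriv.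
case sp: (size p).-1 => [//|n] /=; rewrite ltnNge; apply/negP => sn.
have := nth_default 0 sn; rewrite coef_deriv -sp -lead_coefE => /eqP.
by rewrite mulrn_eq0 lead_coef_eq0 (negPf p0) sp.
Qed.

Lemma size_mul_gcd (p q : {poly K}) : p != 0 -> p = q * D ->
  (size p = size q + size D - 1)%N.
Proof.
move=> p0 pE; rewrite {1}pE size_mul ?gcdp_deriv_neq0 ?subn1 //.
by apply: contra_neq p0 => q0; rewrite pE q0 mul0r.
Qed.

Variable m : nat.
Hypotheses (m0 : (0 < m)%N) (size_g : (size g <= m.+1)%N).
Local Notation q := (m%:R * r - 'X * s).

Lemma sqfree_euler : m%:R * g - 'X * g^`() = q * D.
Proof. by rewrite [in RHS]mulrBl -!mulrA -sqfree_mul -sqfree_deriv. Qed.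

(** The coefficient of degree m vanishes, and in degrees below m no coefficient
    of [g] is lost; so the size drops exactly when [g] has degree m. *)
Lemma coef_euler i : (m%:R * g - 'X * g^`())`_i = (m%:R - i%:R) * g`_i.
Proof.
rewrite coefB -polyC_natr coefCM coefXM coef_deriv mulrBl; congr (_ - _).
by case: i => [|i]; rewrite ?mul0r // mulr_natl.
Qed.

Lemma coprime_sqfree_euler : coprimep s q.
Proof.
rewrite addrC -mulNr coprimep_addl_mul coprimepMr -polyC_natr.
rewrite [coprimep _ r]coprimep_sym coprimep_div_gcd ?g0 // andbT.
by rewrite -alg_polyC coprimepZr ?coprimep1 // pnatr_eq0 -lt0n.
Qed.

(** The size of s is one less than that of [r].  The other polynomial has the
    size of [r] when [g] has degree less than m, and is smaller when the
    leading terms cancel. *)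
Lemma max_size_euler_pair :
  maxn (size s) (size q) = ((size r).-1 + (size g <= m))%N.
Proof.
have sD : (0 < size D)%N by rewrite size_poly_gt0 gcdp_deriv_neq0.
have sr : (0 < size r)%N by rewrite size_poly_gt0 sqfree_neq0.
have sg := size_mul_gcd g0 sqfree_mul.
have ss : size s = (size r).-1.
  have [s0|s0] := eqVneq s 0.
    move: sqfree_deriv; rewrite s0 mul0r size_poly0.
    move=> /(congr1 (size \o val)) /=.
    rewrite size_deriv_char0 size_poly0; move: sg sD sr.
    move: (size g) (size r) (size D) => a b c; lia.
  have d0 : g^`() != 0 by rewrite sqfree_deriv mulf_neq0 ?gcdp_deriv_neq0.
  have := size_mul_gcd d0 sqfree_deriv; rewrite size_deriv_char0.
  have : (0 < size s)%N by rewrite size_poly_gt0.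
  move: sg sD sr; move: (size g) (size r) (size D) (size s) => a b c d; lia.
have gD : (0 < size g)%N by rewrite size_poly_gt0.
have le_Eg : (size (q * D)%R <= size g)%N.
  rewrite -sqfree_euler; apply/leq_sizeP => i /(nth_default 0).
  by rewrite coef_euler => ->; rewrite mulr0.
have [q0|q0] := eqVneq q 0.
  rewrite q0 size_poly0 maxn0 ss; case: leqP => [gm|_]; last by rewrite addn0.
  have := coef_euler (size g).-1; rewrite sqfree_euler q0 mul0r coef0.
  move=> /esym/eqP.
  rewrite -lead_coefE mulf_eq0 lead_coef_eq0 (negPf g0) orbF subr_eq0 eqr_nat.
  by move: gm gD; move: (size g) => a; lia.
have qD0 : q * D != 0 by rewrite mulf_neq0 ?gcdp_deriv_neq0.
have sq := size_mul_gcd qD0 erefl.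
case: (leqP (size g) m) => gm /=.
  have : (size g <= size (q * D)%R)%N.
    rewrite -(prednK gD); apply: contraT; rewrite -leqNgt => /(nth_default 0).
    rewrite -sqfree_euler coef_euler => /eqP.
    rewrite -lead_coefE mulf_eq0 lead_coef_eq0 (negPf g0) orbF subr_eq0 eqr_nat.
    by move: gm gD; move: (size g) => a; lia.
  move: le_Eg sq; rewrite ss; move: (size (q * D)) (size q) sg sr sD.
  by move: (size g) (size r) (size D) => a b c d e; lia.
have : (size (q * D)%R < size g)%N.
  rewrite -(prednK gD) ltnS -sqfree_euler; apply/leq_sizeP => i le_i.
  rewrite coef_euler; have [->|im] := eqVneq i m; first by rewrite subrr mul0r.
  rewrite nth_default ?mulr0 //.
  by move: size_g gm gD le_i im; move: (size g) => a; lia.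
move: sq; rewrite ss; move: (size (q * D)) (size q) sg sr sD.
by move: (size g) (size r) (size D) => a b c d e; lia.
Qed.

End SquareFreePart.

(** * Counting linear factors *)

Lemma sqfree_split (C : numClosedFieldType) (g : {poly C}) : g != 0 ->
  exists zs : seq C, [/\ uniq zs, forall z, root g z = (z \in zs) &
    size zs = (size (g %/ gcdp g g^`())).-1].
Proof.
move=> g0; set r := g %/ _.
have r0 : r != 0 := sqfree_neq0 g0.
have [zs rE] := closed_field_poly_normal r.
have l0 : lead_coef r != 0 by rewrite lead_coef_eq0.
exists zs; split.
- have := make_separable g0; rewrite -/r rE.
  rewrite (@eqp_separable _ _ (\prod_(z <- zs) ('X - z%:P))) ?eqp_scale //.
  by rewrite separable_prod_XsubC.
- by move=> z; rewrite -(sqfree_root g0) -/r rE rootZ // root_prod_XsubC.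
by rewrite rE size_scale // size_prod_XsubC.
Qed.

Section LinearFactorCount.
Variables (C : fieldType) (m : nat) (G : {mpoly C[2]}).
Hypotheses (m0 : (0 < m)%N) (G_hom : G \is m.-homog) (G0 : G != 0).
Variable zs : seq C.
Hypotheses (zs_uniq : uniq zs) (zsP : forall z, root (dehom G) z = (z \in zs)).

Definition affine_form (z : C) : {mpoly C[2]} := 'X_0 - z *: 'X_1.

(** Representatives of the classes of linear factors: one for each root of
    G(t,1), and Y when G(t,1) has degree less than m, that is, when the point at
    infinity is a root. *)
Definition factor_forms : seq {mpoly C[2]} :=
  [seq affine_form z | z <- zs] ++ nseq (size (dehom G) <= m)%N 'X_1.

Lemma dehom_affine z : dehom (affine_form z) = 'X - z%:P.
Proof. by rewrite rmorphB /= dehomZ dehomX0 dehomX1 alg_polyC. Qed.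

Lemma X1_neq0 : 'X_1 != 0 :> {mpoly C[2]}.
Proof.
apply/eqP => /(congr1 (@dehom C)); rewrite dehomX1 rmorph0 => /eqP.
by rewrite oner_eq0.
Qed.

Lemma dhomogX1 (i : 'I_2) : ('X_i : {mpoly C[2]}) \is 1.-homog.
Proof. by rewrite dhomogX /= mdeg1. Qed.

Lemma affine_hom z : affine_form z \is 1.-homog.
Proof. by apply: rpredB; [|apply: dhomogZ]; apply: dhomogX1. Qed.

Lemma dehom_neq0 : dehom G != 0.
Proof.
by apply: contra_neq G0 => dG0; rewrite -(homogen_dehom G_hom) dG0 homogen0.
Qed.

(** A form a X + b Y with a <> 0 divides G exactly when - b / a is a root of
    G(t,1): the quotient by X - z Y is the homogenization of the quotient by
    t - z.  The form Y divides G exactly when G(t,1) homogenizes already in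
    degree m - 1. *)
Lemma factor_formsP l : linear_factors G l <->
  exists2 l', l' \in factor_forms & prop_class l = prop_class l'.
Proof.
have prop_class_scale (c : C) (l1 : {mpoly C[2]}) : c != 0 ->
    prop_class (c *: l1) = prop_class l1.
  move=> c0; apply/seteqP; split=> l' [e e0 ->].
    by exists (e * c); [rewrite mulf_neq0 | rewrite scalerA].
  exists (e / c); first by rewrite mulf_neq0 ?invr_eq0.
  by rewrite scalerA divfK.
have linear_factors_scale (c : C) l1 : c != 0 -> linear_factors G l1 ->
    linear_factors G (c *: l1).
  move=> c0 [[l10 [a [b l1E]]] [q GE]]; split; first split.
  - by rewrite scaler_eq0 negb_or c0.
  - by exists (c * a), (c * b); rewrite l1E scalerDr !scalerA.
  - by exists (c^-1 *: q); rewrite -scalerAl -scalerAr scalerA mulfV ?scale1r.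
split=> [[[l0 [a [b lE]]] [q GE]]|[l' l'F /(congr1 (fun A => A l)) /= ll']].
  have [a0|a0] := eqVneq a 0.
    rewrite a0 scale0r add0r in lE.
    have b0 : b != 0 by apply: contra_neq l0 => b0; rewrite lE b0 scale0r.
    exists 'X_1; last by rewrite lE prop_class_scale.
    rewrite mem_cat; apply/orP; right; rewrite mem_nseq eqxx andbT lt0b.
    have := pihomog_dE G_hom; rewrite {1}GE lE -scalerAl mulrC scalerAl.
    rewrite (pihomogM _ _ (dhomogX1 1)) m0 => <-.
    rewrite rmorphM /= dehomX1 mulr1.
    by rewrite -{2}(subnK m0) addn1 size_dehom // pihomogP.
  exists (affine_form (- b / a)).
    rewrite mem_cat map_f // -zsP GE rmorphM rootM lE rmorphD /= !dehomZ.
    rewrite dehomX0 dehomX1 /root hornerD !hornerZ hornerX hornerC mulr1.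
    by rewrite mulrC divfK // addNr eqxx.
  rewrite lE -(prop_class_scale a (affine_form _)) //; congr prop_class.
  rewrite /affine_form scalerBr scalerA mulNr mulrN scaleNr opprK.
  by rewrite mulrC divfK.
have [c c0 ->] : prop_class l' l.
  by rewrite -ll'; exists 1; rewrite ?oner_eq0 ?scale1r.
apply: linear_factors_scale => //.
move: l'F; rewrite mem_cat mem_nseq => /orP[/mapP[z + ->]|].
  rewrite -zsP => /factor_theorem[q qE]; split; first split.
  - apply/eqP => /(congr1 (@dehom C)); rewrite dehom_affine rmorph0 => /eqP.
    by rewrite polyXsubC_eq0.
  - by exists 1, (- z); rewrite scale1r scaleNr.
  exists (homogen m.-1 q).
  rewrite -(homogen_mul (affine_hom z) (dhomog_homogen _ _)).
  rewrite add1n prednK // dehom_affine dehom_homogen ?prednK //.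
    by rewrite mulrC -qE homogen_dehom.
  have := size_dehom G_hom; have := dehom_neq0; rewrite qE.
  have [->|q0] := eqVneq q 0; first by rewrite mul0r eqxx.
  by rewrite size_Mmonic ?monicXsubC // size_XsubC addn2.
rewrite lt0b => /andP[sG /eqP->]; split; first split.
- exact: X1_neq0.
- by exists 0, 1; rewrite scale0r scale1r add0r.
exists (homogen m.-1 (dehom G)).
rewrite -(homogen_mul (dhomogX1 1) (dhomog_homogen _ _)).
by rewrite add1n prednK // dehomX1 mul1r dehom_homogen ?prednK // homogen_dehom.
Qed.

Lemma factor_forms_inj l l' : l \in factor_forms -> l' \in factor_forms ->
  prop_class l = prop_class l' -> l = l'.
Proof.
move=> lF l'F ll'.
have [c c0 lE] : prop_class l' l.
  by rewrite -ll'; exists 1; rewrite ?oner_eq0 ?scale1r.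
have := congr1 (@dehom C) lE; rewrite dehomZ.
move: lF l'F; rewrite !mem_cat !mem_nseq.
move=> /orP[/mapP[z _ ->]|/andP[_ /eqP->]] /orP[/mapP[z' _ ->]|/andP[_ /eqP->]];
  rewrite ?dehom_affine ?dehomX1 //.
- move=> /(congr1 (fun p : {poly C} => p.[z'])) /eqP.
  by rewrite hornerZ !hornerXsubC subrr mulr0 subr_eq0 => /eqP->.
- move=> /(congr1 (fun p : {poly C} => size p)) /eqP.
  by rewrite size_XsubC size_scale // size_poly1.
move=> /(congr1 (fun p : {poly C} => size p)) /eqP.
by rewrite size_scale // size_XsubC size_poly1.
Qed.

Lemma factor_forms_uniq : uniq factor_forms.
Proof.
rewrite cat_uniq map_inj_uniq ?zs_uniq /=; last first.
  move=> z z' /(congr1 (@dehom C)); rewrite !dehom_affine => /(congr1 (-%R)).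
  by rewrite !opprB => /addIr/polyC_inj.
apply/andP; split; last by case: (_ <= _)%N.
apply/hasPn => l; rewrite mem_nseq => /andP[_ /eqP->]; apply/mapP => -[z _].
move=> /(congr1 (@dehom C)); rewrite dehom_affine dehomX1.
move=> /(congr1 (fun p : {poly C} => size p)) /eqP.
by rewrite size_XsubC size_poly1.
Qed.

Lemma nb_linear_factorsE s : has_nb_linear_factors G s ->
  s = (size zs + (size (dehom G) <= m))%N.
Proof.
have -> : (size zs + (size (dehom G) <= m))%N = size factor_forms.
  by rewrite size_cat size_map size_nseq.
rewrite /has_nb_linear_factors.
have -> : (@prop_class C @` linear_factors G)%classic =
  ((fun i => prop_class (nth 0 factor_forms i)) @`
    `I_(size factor_forms))%classic.
  apply/seteqP; split=> A.
    move=> [l /factor_formsP [l' l'F ll'] <-].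
    exists (index l' factor_forms); first by rewrite /= index_mem.
    by rewrite nth_index // ll'.
  move=> [i /= lti <-]; exists (nth 0 factor_forms i) => //.
  by apply/factor_formsP; exists (nth 0 factor_forms i); rewrite ?mem_nth.
move=> cards; apply/card_eq_II; rewrite card_eq_sym.
apply: card_eq_trans cards; rewrite card_eq_sym; apply: inj_card_eq => i j.
rewrite !inE /= => lti ltj /factor_forms_inj.
rewrite !mem_nth // => /(_ isT isT) /eqP.
by rewrite nth_uniq ?factor_forms_uniq // => /eqP.
Qed.

End LinearFactorCount.

(** * The rank of the second quotient *)

Lemma rVpoly_dim0 (R : nzRingType) n (c : 'rV[R]_n) :
  (n <= 0)%N -> rVpoly c = 0.
Proof.
by move=> n0; apply/eqP; rewrite -size_poly_leq0 (leq_trans (size_poly _ _)).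
Qed.

(** Euler's identity removes the generator g: with n = m, u = gamma, v = gamma'
    and c = 1/m, the multiple of gamma is absorbed by the two others. *)
Lemma absorb_multiple (R : comNzRingType) (a0 a1 a2 u v t c n : R) :
  c * n = 1 ->
  a0 * u + a1 * v + a2 * (n * u - t * v) =
  (a1 + c * t * a0) * v + (a2 + c * a0) * (n * u - t * v).
Proof. by move=> cn; rewrite -[a0 * u]mul1r -cn; ring. Qed.

Section Presentation.
Local Notation x := (letter 0).
Local Notation y := (letter 1).
Variables (f : freeZ) (d : nat).
Local Notation pi := (quo_lie3 f).
Local Notation L p := (pi (lift_normal x y p)).

(** The class of [x,y] times the form of degree d - 2 with coefficients c.  For
    d < 2 the row c is empty, so the truncated degree is harmless. *)
Definition lie_multiple (c : 'rV[int]_(d - 1)) : quo (Defs.L (A := alg f) 3) :=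
  pi (lie x y) * L (homogen (d - 2) (rVpoly c)).

Lemma lie_multiple_zmod_morphism : zmod_morphism lie_multiple.
Proof.
move=> c e; rewrite /lie_multiple -mulrBr; congr (_ * _).
rewrite -rmorphB -raddfB; congr (pi (lift_normal x y _)).
rewrite linearB /= /homogen -sumrB; apply: eq_bigr => i _.
by rewrite coefB scalerBl.
Qed.
HB.instance Definition _ :=
  GRing.isZmodMorphism.Build _ _ lie_multiple lie_multiple_zmod_morphism.

Lemma lie_multipleE c : lie_multiple c = quo_pi (Defs.L (A := alg f) 3)
  (quo_pi [set f]%classic
    (lie x y * lift_normal x y (homogen (d - 2) (rVpoly c)))).
Proof. by apply/esym; exact: (rmorphM (quo_lie3 f)). Qed.

Lemma homogen_rVpoly_small (c : 'rV[int]_(d - 1)) :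
  (d < 2)%N -> homogen (d - 2) (rVpoly c) = 0.
Proof.
by move=> d2; rewrite rVpoly_dim0 ?homogen0 //; exact: (@leq_sub2r 1 _ 1).
Qed.

Lemma M2_lie_mul q :
  M (A := alg f) 2 (quo_pi [set f]%classic (lie x y * lift_normal x y q)).
Proof.
have -> : quo_pi [set f]%classic (lie x y * lift_normal x y q) =
    1 * lie (quo_pi [set f]%classic x) (quo_pi [set f]%classic y)
    * quo_pi [set f]%classic (lift_normal x y q).
  by rewrite mul1r -quo_pi_lie; apply: rmorphM.
by move=> I [[_ I_mul] I_sub]; apply: I_mul; apply: I_sub; exact: L2_lie.
Qed.

Lemma homogeneous_lie_lift (c : 'rV[int]_(d - 1)) :
  homogeneous d (lie x y * lift_normal x y (homogen (d - 2) (rVpoly c))).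
Proof.
have [d2|d2] := leqP 2 d; last first.
  by rewrite homogen_rVpoly_small // raddf0 mulr0; apply: homogeneous0.
rewrite -{1}(subnKC d2); apply: homogeneousM.
  exact: homogeneous_lie_letters.
by apply: homogeneous_lift_normal; apply: dhomog_homogen.
Qed.

Lemma lie_multiple_N2 c : Ndeg (algdeg f) 2 d (lie_multiple c).
Proof.
rewrite lie_multipleE; split.
  exact: (ex_intro2 _ _ _ (M2_lie_mul _) erefl).
refine (ex_intro2 _ _ _ _ erefl).
exists (lie x y * lift_normal x y (homogen (d - 2) (rVpoly c))); last first.
  exact: erefl.
exact: homogeneous_lie_lift.
Qed.

Lemma normal_form_freeZ a :
  pi a = L (abel a) - pi (lie x y) * L (inversions a).
Proof.
exact: (normal_form (ab := abel) (iv := inversions) inversionsM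
  (abel_letter 0) (abel_letter 1) (inversions_letter 0) (inversions_letter 1)
  (quo_lie3_lie_lie f) freeZ_letter_ind).
Qed.

Lemma lie_lift_Dx p : pi (lie x y) * L (Dx (abel f) * p) = 0.
Proof.
exact: (omega_lift_Dx (ab := abel) (iv := inversions) inversionsM
  (abel_letter 0) (abel_letter 1) (inversions_letter 0) (inversions_letter 1)
  (quo_lie3_lie_lie f) freeZ_letter_ind _ (quo_lie3_f f)).
Qed.

Lemma lie_lift_Dy p : pi (lie x y) * L (Dy (abel f) * p) = 0.
Proof.
exact: (omega_lift_Dy (ab := abel) (iv := inversions) inversionsM
  (abel_letter 0) (abel_letter 1) (inversions_letter 0) (inversions_letter 1)
  (quo_lie3_lie_lie f) freeZ_letter_ind _ (quo_lie3_f f)).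
Qed.

Variable m : nat.
Hypothesis f_hom : homogeneous m f.
Local Notation g := (abel f).

Lemma N2_abel a : N (A := alg f) 2 (pi a) -> exists u, abel a = u * g.
Proof. exact: (N2_ab (ab := abel) (iv := inversions) inversionsM). Qed.

(** A homogeneous element of N_2 has a representative a of degree d, and
    a_ab = u g because N_2 has zero image in the abelianization of A.
    Subtracting a lift of u times f leaves a representative with zero
    abelianization, and its normal form is a multiple of [x,y]. *)
Lemma lie_multiple_onto z :
  Ndeg (algdeg f) 2 d z -> exists c, z = lie_multiple c.
Proof.
move=> [Nz [_ [a a_hom <-] zE]].
have [u auE] : exists u, abel a = u * g.
  by apply: N2_abel; move: Nz; rewrite -zE.
have g_hom := homogeneous_abel f_hom.
(* The component of u in degree d - m still satisfies a_ab = u' g, and it makes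
   the correction homogeneous of degree d. *)
pose u' := if (m <= d)%N then pihomog mdeg (d - m) u else 0.
have au'E : abel a = u' * g.
  rewrite -(pihomog_dE (homogeneous_abel a_hom)) auE (pihomogM _ _ g_hom) /u'.
  by case: ifP => //; rewrite mul0r.
pose b := lift_normal x y u' * f.
have b_hom : homogeneous d b.
  rewrite /b /u'; case: leqP => [le_md|_].
    by rewrite -{1}(subnK le_md); apply: homogeneousM => //;
      apply: homogeneous_lift_normal; apply: pihomogP.
  by rewrite raddf0 mul0r; apply: homogeneous0.
have ab0 : abel (a - b) = 0.
  have -> : abel (a - b) = abel a - abel b by exact: raddfB.
  have -> : abel b = u' * g.
    rewrite -[in RHS](ab_lift (ab := abel) (abel_letter 0) (abel_letter 1) u').
    exact: abelM.
  by rewrite au'E subrr.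
have piab : pi (a - b) = pi a.
  have pib : pi b = 0.
    have -> : pi b = pi (lift_normal x y u') * pi f by exact: rmorphM.
    by rewrite quo_lie3_f mulr0.
  have -> : pi (a - b) = pi a - pi b by exact: rmorphB.
  by rewrite pib subr0.
have [iv_hom iv0] :=
  homogeneous_inversions (homogeneousD a_hom (homogeneousN b_hom)).
exists (- poly_rV (dehom (inversions (a - b)))).
have -> : lie_multiple (- poly_rV (dehom (inversions (a - b)))) =
    - lie_multiple (poly_rV (dehom (inversions (a - b)))) by exact: raddfN.
rewrite -zE -[LHS]/(pi a) -piab normal_form_freeZ ab0 [lift_normal _ _ 0]raddf0.
rewrite rmorph0 sub0r /lie_multiple; congr (- (_ * pi (lift_normal x y _))).
have [d2|d2] := leqP 2 d; last by rewrite iv0 // rmorph0 !linear0 homogen0.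
rewrite poly_rV_K ?homogen_dehom // (leq_trans (size_dehom iv_hom)) //; lia.
Qed.

(** Its rows are the coefficients of the products of the two partial
    derivatives of g by the monomials of degree d - 1 - m, at Y = 1. *)
Definition jacobian_mx : 'M[int]_((d - m) + (d - m), d - 1) :=
  combinations_mx (d - m) (d - 1) (dehom g)^`()
    (m%:R * dehom g - 'X * (dehom g)^`()).

Hypothesis m0 : (0 < m)%N.

Lemma lie_multiple_jacobian w : lie_multiple (w *m jacobian_mx) = 0.
Proof.
have g_hom := homogeneous_abel f_hom.
rewrite mul_combinations_mx; set a := rVpoly _; set b := rVpoly _.
have sa : (size a <= d - m)%N by apply: size_poly.
have sb : (size b <= d - m)%N by apply: size_poly.
have [le_dm|lt_md] := leqP d m.
  have -> : a = 0 by apply/eqP; rewrite -size_poly_leq0; lia.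
  have -> : b = 0 by apply/eqP; rewrite -size_poly_leq0; lia.
  by rewrite !mul0r addr0 linear0; apply: raddf0.
have [k dE] : exists k, d = (m + k).+1 by exists (d - m).-1; lia.
have d2E : (d - 2 = m.-1 + k)%N by lia.
pose q := Dx g * homogen k a + Dy g * homogen k b.
have q_hom : q \is (d - 2).-homog.
  rewrite d2E; apply: rpredD; apply: dhomogM;
    by [apply: dhomog_mderiv | apply: dhomog_homogen].
have qE : dehom q =
    a * (dehom g)^`() + b * (m%:R * dehom g - 'X * (dehom g)^`()).
  rewrite rmorphD !rmorphM /= dehom_Dx (dehom_Dy g_hom) !dehom_homogen; try lia.
  by rewrite [_ * a]mulrC [_ * b]mulrC.
rewrite -qE /lie_multiple poly_rV_K; last first.
  by rewrite (leq_trans (size_dehom q_hom)) //; lia.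
rewrite homogen_dehom // /q.
have -> : L (Dx g * homogen k a + Dy g * homogen k b) =
    L (Dx g * homogen k a) + L (Dy g * homogen k b).
  exact: (pi_liftD x y (quo_lie3 f)).
apply: (etrans (mulrDr _ _ _)).
exact: (etrans (congr2 _ (lie_lift_Dx _) (lie_lift_Dy _)) (addr0 _)).
Qed.

Hypothesis g0 : g != 0.

Lemma ratmx_jacobian_mx : ratmx jacobian_mx =
  combinations_mx (d - m) (d - 1) (ratp (dehom g))^`()
    (m%:R * ratp (dehom g) - 'X * (ratp (dehom g))^`()).
Proof.
rewrite map_combinations_mx; congr combinations_mx; first by rewrite deriv_map.
by rewrite rmorphB !rmorphM /= rmorph_nat map_polyX deriv_map.
Qed.

Lemma lie_multiple_eq0 c :
  lie_multiple c = 0 -> (ratmx c <= ratmx jacobian_mx)%MS.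
Proof.
have g_hom := homogeneous_abel f_hom.
have [d2|d2] := leqP d 1.
  move=> _; suff -> : c = 0 by rewrite map_mx0 sub0mx.
  by apply/rowP => -[i lti]; exfalso; lia.
rewrite /lie_multiple -rmorphM.
move=> /(omega_lift_eq0 (ab := abel) (iv := inversions) inversionsM
  (abel_letter 0) (abel_letter 1) g0) Jq.
have [a0 [a1 [a2 [s0 s1 s2]]]] :=
  jacobian_ideal_dehom m0 g_hom (dhomog_homogen _ _) Jq.
rewrite dehom_homogen; last by rewrite (leq_trans (size_poly _ _)) //; lia.
move=> cE.
have {cE} : ratp (rVpoly c) = ratp a0 * ratp (dehom g)
    + ratp a1 * (ratp (dehom g))^`()
    + ratp a2 * (m%:R * ratp (dehom g) - 'X * (ratp (dehom g))^`()).
  rewrite cE !(rmorphD, rmorphM, rmorphB, rmorphN) /=.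
  by rewrite rmorph_nat map_polyX deriv_map.
have mQ : m%:R != 0 :> rat by rewrite pnatr_eq0 -lt0n.
set G := ratp (dehom g) => cE.
pose b1 := ratp a1 + (m%:R^-1)%:P * 'X * ratp a0.
pose b2 := ratp a2 + (m%:R^-1)%:P * ratp a0.
have {}cE : ratp (rVpoly c) = b1 * G^`() + b2 * (m%:R * G - 'X * G^`()).
  rewrite cE; apply: absorb_multiple.
  by rewrite -polyC_natr -polyCM mulVf.
have sr (p : {poly int}) : size (ratp p) = size p.
  by rewrite size_map_inj_poly //; apply: intr_inj.
have sC (p : {poly rat}) : (size ((m%:R^-1)%:P * p)%R <= size p)%N.
  by rewrite mul_polyC size_scale_leq.
have sb1 : (size b1 <= d - m)%N.
  rewrite (leq_trans (size_polyD _ _)) // geq_max sr.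
  apply/andP; split; first lia.
  rewrite -mulrA (leq_trans (sC _)) //.
  have [->|a00] := eqVneq (ratp a0) 0; first by rewrite mulr0 size_poly0.
  rewrite mulrC size_mulX // sr.
  by move: a00; rewrite -size_poly_gt0 sr => ?; lia.
have sb2 : (size b2 <= d - m)%N.
  rewrite (leq_trans (size_polyD _ _)) // geq_max sr.
  apply/andP; split; first lia.
  by rewrite (leq_trans (sC _)) // sr; lia.
apply/submxP; exists (row_mx (poly_rV b1) (poly_rV b2)).
rewrite ratmx_jacobian_mx mul_combinations_mx row_mxKl row_mxKr.
by rewrite !poly_rV_K // -cE -map_poly_rV rVpolyK.
Qed.

Lemma has_rank_Ndeg2 :
  has_rank (Ndeg (algdeg f) 2 d) (d - 1 - \rank (ratmx jacobian_mx)).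
Proof.
exact: has_rank_quotient lie_multiple_N2 lie_multiple_onto
  lie_multiple_jacobian lie_multiple_eq0.
Qed.

(** The rank is computed over the rationals, while the linear factors live over
    the complex numbers; the square-free part of g(t,1) commutes with the
    extension of scalars and makes the link. *)
Lemma rank_jacobian_mx (C : numClosedFieldType) s :
  has_nb_linear_factors (map_mpoly (intr : int -> C) g) s ->
  (0 < s)%N /\
  \rank (ratmx jacobian_mx) = ((d - m) + (d - m) - ((d - m) - (s - 1)))%N.
Proof.
have g_hom := homogeneous_abel f_hom.
set G := ratp (dehom g).
have dg0 : dehom g != 0.
  by apply: contra_neq g0 => dg0; rewrite -(homogen_dehom g_hom) dg0 homogen0.
have sGg : size G = size (dehom g).
  by rewrite size_map_inj_poly //; apply: intr_inj.
have G0 : G != 0 by rewrite -size_poly_gt0 sGg size_poly_gt0.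
have sG : (size G <= m.+1)%N by rewrite sGg size_dehom.
move=> /nb_linear_factorsE sE.
have sE' : s = maxn (size (G^`() %/ gcdp G G^`())%R)
   (size (m%:R * (G %/ gcdp G G^`()) - 'X * (G^`() %/ gcdp G G^`()))%R).
  rewrite max_size_euler_pair //.
  have dgC : dehom (map_mpoly (intr : int -> C) g) =
      map_poly (ratr : rat -> C) G.
    rewrite dehom_map -map_poly_comp; apply: eq_map_poly => c /=.
    by rewrite ratr_int.
  have GC0 : map_poly (ratr : rat -> C) G != 0 by rewrite map_poly_eq0.
  have [zs [zs_uniq zsP zsE]] := sqfree_split GC0.
  rewrite -dgC in zsP.
  have -> := sE m m0 _ _ zs zs_uniq zsP.
  - rewrite dgC zsE size_map_poly; congr (_.-1 + _)%N.
    by rewrite deriv_map -gcdp_map -map_divp size_map_poly.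
  - apply/dhomogP => mm; rewrite mcoeff_msupp mcoeff_map_mpoly intr_eq0.
    by rewrite -mcoeff_msupp => /(dhomogP _ _ _ g_hom).
  by apply: contra_neq GC0; rewrite -dgC => ->; rewrite rmorph0.
have s0 : (0 < s)%N.
  rewrite sE' leq_max !size_poly_gt0.
  exact: coprime_pair_neq0 (coprime_sqfree_euler G0 m0).
split=> //.
have [le_dm|lt_md] := leqP d m.
  have k0 : (d - m = 0)%N by lia.
  have := rank_leq_row (ratmx jacobian_mx).
  by move: (\rank _) => r; lia.
rewrite ratmx_jacobian_mx -/G {1}(sqfree_deriv G) sqfree_euler sE'.
apply: rank_combinations_mx.
- exact: gcdp_deriv_neq0.
- exact: coprime_sqfree_euler.
rewrite -sqfree_deriv -sqfree_euler.
have sE1 : (size G^`() <= m)%N.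
  by rewrite size_deriv_char0 -subn1 leq_subLR add1n.
have sE2 : (size (m%:R * G - 'X * G^`())%R <= m)%N.
  apply/leq_sizeP => i le_mi; rewrite coef_euler.
  have [->|im] := eqVneq i m; first by rewrite subrr mul0r.
  by rewrite nth_default ?mulr0 // (leq_trans sG) // ltn_neqAle eq_sym im.
have bound (e : nat) : (e <= m)%N -> (e + (d - m) <= (d - 1).+1)%N by lia.
by split; apply: bound.
Qed.

End Presentation.

Lemma homogeneous0_int a : homogeneous 0 a -> exists c : int, a = c%:~R.
Proof.
elim/homogeneous_ind => [|{}a b [c ->] [e ->]|c w /size0nil w0].
- by exists 0.
- by exists (c + e); rewrite rmorphD.
exists c; have -> : w = monalg.mone.
  by apply/val_inj; rewrite [RHS]monalg.fm1.
by rewrite -{1}[c]intz; apply: (raddfMz (monalg.mkmalgU _)).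
Qed.

Lemma has_rank_torsion (V : zmodType) (H : set V) (c : int) : c != 0 ->
  (forall z : V, z *~ c = 0) -> has_rank H 0.
Proof.
move=> c0 Vc; split; first by exists (fun=> 0); split=> [[]|c' _ []].
move=> n g _ g_free; rewrite leqn0; apply: contraT => n0.
have n1 : (0 < n)%N by rewrite lt0n.
have /g_free /(_ (Ordinal n1)) cE : \sum_(i < n) g i *~ c = 0.
  by rewrite big1.
by rewrite cE eqxx in c0.
Qed.

Theorem theorem3p7 (R : realType) (m s : nat) (f : freeZ)
  (f_hom : homogeneous m f)
  (fab_neq0 : abel f != 0)
  (s_factors : has_nb_linear_factors
                 (map_mpoly (intr : int -> R[i]) (abel f)) s)
  (d : nat) :
  has_rank (Ndeg (algdeg f) 2 d)
    (if d == 0 then 0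
     else if d <= m - 1 then d - 1
     else if d <= m + s - 1 then 2 * m - d - 1
     else m - s)%N.
Proof.
have [m0|m0] := posnP m.
  have -> : (if d == 0 then 0 else if d <= m - 1 then d - 1
     else if d <= m + s - 1 then 2 * m - d - 1 else m - s)%N = 0%N.
    rewrite m0; case: (d == 0)%N => //.
    by case: ifP => ?; [|case: ifP => ?]; lia.
  (* A form of degree zero is a nonzero integer c, which is zero in A. *)
  rewrite m0 in f_hom; have [c fE] := homogeneous0_int f_hom.
  apply: (@has_rank_torsion _ _ c).
    by apply: contra_neq fab_neq0 => c0; rewrite fE c0; apply: abel0.
  move=> z; have c0 : c%:~R = 0 :> quo (Defs.L (A := alg f) 3).
    apply: (etrans (esym (rmorph_int (quo_lie3 f) c))).
    exact: (etrans (esym (congr1 (quo_lie3 f) fE)) (quo_lie3_f f)).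
  by rewrite -mulrzl c0 mul0r.
have [s0 rankE] := rank_jacobian_mx d f_hom m0 fab_neq0 s_factors.
have := has_rank_Ndeg2 d f_hom m0 fab_neq0; rewrite rankE.
set r1 := (X in has_rank _ X); set r2 := (X in _ -> has_rank _ X).
suff -> : r1 = r2 by [].
rewrite /r1 /r2; case: (eqVneq d 0%N) => [->|d0]; first lia.
by case: ifP => d1; [|case: ifP => d2]; lia.
Qed.
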